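(* Let $T=(\Sigma, s_0)$ be an asynchronous transition system with state space $\Sigma=(S, E, I,\mathrm{Tran})$, and suppose that $T$ does not contain infinite subsets of mutually independent events. Suppose that the set $E$ is totally ordered. Then the groups $H_n(K_*(T(s_0)), \Delta\mathbb{Z})$, $n\ge 0$, are isomorphic to the homology groups of the complex $$0 \leftarrow \bigoplus_{s\in S(s_0)} \mathbb{Z} \stackrel{d_1}\longleftarrow \bigoplus_{(s,e_1)\in S(s_0)\times E_1} \mathbb{Z} \stackrel{d_2}\longleftarrow \bigoplus_{(s, e_1, e_2)\in S(s_0)\times E_2} \mathbb{Z} \leftarrow \cdots \leftarrow \bigoplus_{(s, e_1,\ldots, e_{n-1})\in S(s_0)\times E_{n-1}} \mathbb{Z} \stackrel{d_n}\longleftarrow \bigoplus_{(s, e_1,\ldots, e_{n})\in S(s_0)\times E_{n}} \mathbb{Z} \leftarrow \cdots$$ where $E_n$ is the set of tuples $(e_1,\ldots,e_n)$ of mutually commuting (pairwise in $I$) elements $e_1<\cdots<e_n$ of $E$, and $$d_n(s,e_1,\ldots, e_n) = \sum_{i=1}^n(-1)^i \left( (s\cdot e_i, e_1, \ldots, \widehat{e_i}, \ldots, e_n)- (s, e_1, \ldots, \widehat{e_i}, \ldots, e_n) \right).$$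
   Context: An asynchronous transition system $T=(\Sigma,s_0)$ consists of a state space $\Sigma=(S,E,I,\mathrm{Tran})$ and an initial state $s_0\in S$, where $S$ (states) and $E$ (events) are sets, $I\subseteq E\times E$ is an irreflexive symmetric relation (independence), and $\mathrm{Tran}\subseteq S\times E\times S$ satisfies: (i) for every $e\in E$ there are $s,s'\in S$ with $(s,e,s')\in\mathrm{Tran}$; (ii) if $(s,e,s'),(s,e,s'')\in\mathrm{Tran}$ then $s'=s''$; (iii) for any $(e_1,e_2)\in I$ and $(s,e_1,s_1),(s_1,e_2,u)\in\mathrm{Tran}$ there is $s_2\in S$ with $(s,e_2,s_2),(s_2,e_1,u)\in\mathrm{Tran}$. Events $e_j$, $j\in J$, are mutually independent if $(e_j,e_{j'})\in I$ for all $j\ne j'$ in $J$. $M(E,I)$ is the monoid with generators $E$ and relations $ab=ba$ for $(a,b)\in I$. It acts on the right on $S\sqcup\{\star\}$ by: $s\cdot e=s'$ if $(s,e,s')\in\mathrm{Tran}$, $s\cdot e=\star$ if there is no such $s'$, and $\star\cdot e=\star$. A state $s\in S\sqcup\{\star\}$ is available if $s=s_0\cdot\mu$ for some $\mu\in M(E,I)$. $S(s_0)\subseteq S\sqcup\{\star\}$ is the set of available states; $M(E,I)$ acts on it on the right. $T(s_0)$ denotes the space of available states, i.e. $S(s_0)$ with this action, and $K_*(T(s_0))$ is the category with object set $S(s_0)$, morphisms $s_1\stackrel{\mu}\to s_2$ with $\mu\in M(E,I)$, $s_1\cdot\mu=s_2$, and composition of $s_1\stackrel{\mu_1}\to s_2$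 followed by $s_2\stackrel{\mu_2}\to s_3$ equal to $s_1\stackrel{\mu_1\mu_2}\to s_3$. For a small category $\mathscr{C}$, $\Delta\mathbb{Z}:\mathscr{C}\to\mathrm{Ab}$ is the constant functor with value $\mathbb{Z}$ (identity on morphisms), and $H_n(\mathscr{C},\Delta\mathbb{Z})=\varinjlim_n^{\mathscr{C}}\Delta\mathbb{Z}$ is the value of the $n$-th left derived functor of the colimit functor $\mathrm{Ab}^{\mathscr{C}}\to\mathrm{Ab}$ (equivalently, the $n$-th integral homology of the nerve of $\mathscr{C}$). *)

(* Defs.v *)
From HB Require Import structures.
From mathcomp Require Import all_boot all_order all_algebra.
From mathcomp Require Import boolp classical_sets cardinality.
From mathcomp.multinomials Require Import freeg.
From mathcomp Require Import zify.

Set Implicit Arguments.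
Unset Strict Implicit.
Unset Printing Implicit Defensive.

Import Order.TTheory GRing.Theory.
Local Open Scope ring_scope.
Local Open Scope quotient_scope.

Section FreeExtension.
Variables (K : choiceType) (A : zmodType).

(* [zmodule A] is [A] seen as a module over [int]. *)
Definition fgext (f : K -> A) : {freeg K} -> A := @fglift int (zmodule A) K f.

Lemma fgext_is_zmod_morphism f : zmod_morphism (fgext f).
Proof. exact: (@lift_is_additive int K (zmodule A) f). Qed.

HB.instance Definition _ f :=
  GRing.isZmodMorphism.Build {freeg K} A (fgext f) (fgext_is_zmod_morphism f).

Lemma fgextU f k : fgext f << k >> = f k.
Proof. by rewrite /fgext liftU scale1r. Qed.

Lemma freeg_morph_ext (f g : {additive {freeg K} -> A}) :
  (forall k, f << k >> = g << k >>) -> f =1 g.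
Proof.
move=> fg D; rewrite -[D]freeg_sumE !raddf_sum; apply: eq_bigr => k _.
have -> : << coeff k D *g k >> = << k >> *~ coeff k D.
  by rewrite freegU_mulz; congr << _ *g _ >>; rewrite -[LHS]intz.
by rewrite !raddfMz fg.
Qed.

End FreeExtension.

Lemma quot_eq0 (V : zmodType) (I : zmodClosed V) (x : V) :
  (\pi_(Quotient.quot I) x == 0) = (x \in I).
Proof.
rewrite -[in RHS](subr0 x) Quotient.idealrBE.
by rewrite (raddf0 (\pi_(Quotient.quot I) : {additive _ -> _})).
Qed.

Section QuotientLift.
Variables (V W : zmodType) (I : zmodClosed V) (f : {additive V -> W}).
Hypothesis fI : forall x, x \in I -> f x = 0.

Let lift_fun (x : Quotient.quot I) : W := f (repr x).

Let lift_funE x : lift_fun (\pi_(Quotient.quot I) x) = f x.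
Proof.
apply/eqP; rewrite -subr_eq0 -raddfB /=; apply/eqP/fI.
by rewrite Quotient.idealrBE reprK.
Qed.

Let lift_fun_is_zmod_morphism : zmod_morphism lift_fun.
Proof.
move=> x y; rewrite -[x]reprK -[y]reprK.
by rewrite -raddfB !lift_funE raddfB.
Qed.

Definition quot_lift : {additive Quotient.quot I -> W} :=
  HB.pack lift_fun
    (GRing.isZmodMorphism.Build _ _ lift_fun lift_fun_is_zmod_morphism).

Lemma quot_liftE x : quot_lift (\pi_(Quotient.quot I) x) = f x.
Proof. exact: lift_funE. Qed.

End QuotientLift.

Record chain_complex := ChainComplex {
  chain :> nat -> zmodType;
  bd : forall n, {additive chain n.+1 -> chain n};
  bd_bd : forall n x, bd n (bd n.+1 x) = 0
}.

Section Homology.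
Variable X : chain_complex.

(* Degree 0 is mapped to the zero group. *)
Definition is_cycle n : {pred X n} :=
  match n return {pred X n} with
  | 0 => fun=> true
  | m.+1 => fun x => bd X m x == 0
  end.

Lemma is_cycle_zmod_closed n : zmod_closed (@is_cycle n).
Proof.
case: n => [|n]; split=> //; first by rewrite unfold_in /= raddf0.
by move=> x y /eqP dx /eqP dy; rewrite unfold_in /= raddfB dx dy subrr.
Qed.

Variable n : nat.

HB.instance Definition _ :=
  GRing.isZmodClosed.Build (X n) (@is_cycle n) (@is_cycle_zmod_closed n).

Record cycle := Cycle { cycle_val : X n; _ : cycle_val \in @is_cycle n }.

HB.instance Definition _ := [isSub for cycle_val].
HB.instance Definition _ := [Choice of cycle by <:].
HB.instance Definition _ := [SubChoice_isSubZmodule of cycle by <:].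

Definition is_boundary : {pred cycle} :=
  fun z => `[< exists x, bd X n x = val z >].

Lemma is_boundary_zmod_closed : zmod_closed is_boundary.
Proof.
split; first by apply/asboolP; exists 0; rewrite !raddf0.
move=> z w /asboolP[x xE] /asboolP[y yE].
by apply/asboolP; exists (x - y); rewrite !raddfB xE yE.
Qed.

HB.instance Definition _ :=
  GRing.isZmodClosed.Build cycle is_boundary is_boundary_zmod_closed.

Definition homology : zmodType := Quotient.quot is_boundary.

End Homology.

Definition isomorphic (A B : zmodType) : Prop :=
  exists f : {additive A -> B}, bijective f.

(* [compc f g] is [f] followed by [g]. *)
Record category := Category {
  object :> choiceType;
  hom : object -> object -> choiceType;
  idc : forall a, hom a a;
  compc : forall a b c, hom a b -> hom b c -> hom a c;
  compc1f : forall a b (f : hom a b), compc (idc a) f = f;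
  compcf1 : forall a b (f : hom a b), compc f (idc b) = f;
  compcA : forall a b c d (f : hom a b) (g : hom b c) (h : hom c d),
    compc f (compc g h) = compc (compc f g) h
}.

Record functor (C : category) := Functor {
  fobj :> C -> zmodType;
  fmap : forall a b, hom a b -> {additive fobj a -> fobj b};
  fmap1 : forall a x, fmap (idc a) x = x;
  fmapM : forall a b c (f : hom a b) (g : hom b c) x,
    fmap (compc f g) x = fmap g (fmap f x)
}.

Record nattrans (C : category) (F G : functor C) := NatTrans {
  napp :> forall a, {additive F a -> G a};
  naturality : forall a b (f : hom a b) x, napp b (fmap F f x) = fmap G f (napp a x)
}.

Definition constZ (C : category) : functor C :=
  @Functor C (fun=> int) (fun _ _ _ => idfun) (fun _ _ => erefl)
    (fun _ _ _ _ _ _ => erefl).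

(* Epimorphisms of functors to abelian groups are the pointwise surjections. *)
Definition projective (C : category) (P : functor C) : Prop :=
  forall (F G : functor C) (p : nattrans F G) (u : nattrans P G),
    (forall a y, exists x, p a x = y) ->
  exists v : nattrans P F, forall a x, p a (v a x) = u a x.

Record projective_resolution (C : category) (F : functor C) := ProjectiveResolution {
  res :> nat -> functor C;
  res_bd : forall n, nattrans (res n.+1) (res n);
  res_aug : nattrans (res 0) F;
  res_projective : forall n, projective (res n);
  res_aug_surj : forall a y, exists x, res_aug a x = y;
  res_exact0 : forall a x, res_aug a x = 0 <-> exists y, res_bd 0 a y = x;
  res_exactS : forall n a x,
    res_bd n a x = 0 <-> exists y, res_bd n.+1 a y = x
}.

Section Colimit.
Variables (C : category) (F : functor C).

Definition colim_elt : choiceType := {a : C & F a}.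
Definition colim_pt (a : C) (x : F a) : colim_elt := Tagged (fun a => F a : choiceType) x.

(* The subgroup generated by the relations that make [colim_pt] additive at each
   object and invariant under the morphisms of [C]. *)
Inductive colim_rel : {freeg colim_elt} -> Prop :=
| colim_rel0 : colim_rel 0
| colim_relB u v : colim_rel u -> colim_rel v -> colim_rel (u - v)
| colim_relD a (x y : F a) :
    colim_rel (<< colim_pt (x + y) >> - << colim_pt x >> - << colim_pt y >>)
| colim_rel_map a b (f : hom a b) (x : F a) :
    colim_rel (<< colim_pt (fmap F f x) >> - << colim_pt x >>).

Definition colim_relb : {pred {freeg colim_elt}} := fun u => `[< colim_rel u >].

Lemma colim_relb_zmod_closed : zmod_closed colim_relb.
Proof.
split; first by apply/asboolP; exact: colim_rel0.
by move=> u v /asboolP ru /asboolP rv; apply/asboolP; exact: colim_relB.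
Qed.

HB.instance Definition _ :=
  GRing.isZmodClosed.Build {freeg colim_elt} colim_relb colim_relb_zmod_closed.

Definition colim : zmodType := Quotient.quot colim_relb.

Definition colim_in (a : C) (x : F a) : colim := \pi_colim << colim_pt x >>.

Lemma colim_in_is_zmod_morphism a : zmod_morphism (@colim_in a).
Proof.
have inD (x y : F a) : colim_in (x + y) = colim_in x + colim_in y.
  apply/eqP; rewrite -subr_eq0 opprD addrA /colim_in -!raddfB /=.
  by rewrite quot_eq0; apply/asboolP; exact: colim_relD.
move=> x y; apply/eqP; rewrite eq_sym subr_eq -inD.
by rewrite subrK.
Qed.

HB.instance Definition _ a :=
  GRing.isZmodMorphism.Build (F a) colim (@colim_in a) (@colim_in_is_zmod_morphism a).

Lemma colim_in_fmap a b (f : hom a b) x : colim_in (fmap F f x) = colim_in x.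
Proof.
apply/eqP; rewrite -subr_eq0 /colim_in -raddfB /=.
by rewrite quot_eq0; apply/asboolP; exact: colim_rel_map.
Qed.

Section Descent.
Variables (A : zmodType) (c : forall a, {additive F a -> A}).
Hypothesis cc : forall a b (f : hom a b) x, c b (fmap F f x) = c a x.

Let desc0 : {additive {freeg colim_elt} -> A} := fgext (fun u : colim_elt => c (tag u) (tagged u)).

Lemma colim_desc_subproof u : u \in colim_relb -> desc0 u = 0.
Proof.
move=> /asboolP; elim=> [|v w _ v0 _ w0|a x y|a b f x].
- by rewrite raddf0.
- by rewrite raddfB v0 w0 subrr.
- by rewrite !raddfB /= !fgextU /= raddfD -addrA -opprD subrr.
- by rewrite raddfB /= !fgextU /= cc subrr.
Qed.

Definition colim_desc : {additive colim -> A} := quot_lift colim_desc_subproof.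

Lemma colim_descE a x : colim_desc (@colim_in a x) = c a x.
Proof. by rewrite /colim_desc quot_liftE /= fgextU. Qed.

Lemma colim_desc_uniq (g : {additive colim -> A}) :
  (forall a x, g (@colim_in a x) = c a x) -> g =1 colim_desc.
Proof.
move=> gc z; rewrite -[z]reprK.
pose h : {additive {freeg colim_elt} -> A} := g \o \pi_colim.
pose k : {additive {freeg colim_elt} -> A} := colim_desc \o \pi_colim.
rewrite -/(h _) -/(k _); apply: (@freeg_morph_ext _ _ h k) => -[a x].
by rewrite -[RHS]/(colim_desc (colim_in x)) colim_descE -gc.
Qed.

End Descent.
End Colimit.

Section ColimitMap.
Variables (C : category) (F G : functor C) (u : nattrans F G).

Let colim_map_cocone a : {additive F a -> colim G} := @colim_in C G a \o u a.

Lemma colim_map_subproof a b (f : hom a b) x :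
  colim_map_cocone b (fmap F f x) = colim_map_cocone a x.
Proof. by rewrite /= naturality colim_in_fmap. Qed.

Definition colim_map : {additive colim F -> colim G} :=
  colim_desc colim_map_subproof.

Lemma colim_mapE a (x : F a) : colim_map (colim_in x) = colim_in (u a x).
Proof. exact: colim_descE. Qed.

End ColimitMap.

Section ColimComplex.
Variables (C : category) (F : functor C) (P : projective_resolution F).

Lemma colim_complex_bd_bd n x :
  colim_map (res_bd P n) (colim_map (res_bd P n.+1) x) = 0.
Proof.
pose h : {additive colim (P n.+2) -> colim (P n)} :=
  colim_map (res_bd P n) \o colim_map (res_bd P n.+1).
pose c a : {additive P n.+2 a -> colim (P n)} := \0.
have cc a b (f : hom a b) y : c b (fmap (P n.+2) f y) = c a y by [].
have z a y : (\0 : {additive colim (P n.+2) -> colim (P n)}) (@colim_in _ _ a y)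
  = c a y by [].
rewrite -/(h x) -[RHS]/((\0 : {additive _ -> _}) x).
rewrite (colim_desc_uniq cc z); apply: (@colim_desc_uniq _ _ _ c cc h) => a y.
rewrite -[LHS]/(colim_map (res_bd P n) (colim_map (res_bd P n.+1) (colim_in y))).
rewrite !colim_mapE.
have -> : res_bd P n a (res_bd P n.+1 a y) = 0 by apply/res_exactS; exists y.
exact: raddf0.
Qed.

Definition colim_complex : chain_complex := ChainComplex colim_complex_bd_bd.

End ColimComplex.

(* The standard resolution: [free_cover F] is the free functor on the
   underlying family of sets of [F]; it is iterated on the kernels. *)

Section FreeCover.
Variables (C : category) (F : functor C).

Definition free_gen (c : C) : choiceType := {a : C & (hom a c * F a)%type}.
Definition free_pt c a (f : hom a c) (x : F a) : free_gen c :=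
  Tagged (fun a => (hom a c * F a)%type : choiceType) (f, x).

Definition free_push b c (g : hom b c) (u : free_gen b) : {freeg (free_gen c)} :=
  << free_pt (compc (tagged u).1 g) (tagged u).2 >>.

Definition free_map b c (g : hom b c) : {additive {freeg (free_gen b)} -> {freeg (free_gen c)}} :=
  fgext (free_push g).

Lemma free_mapE a b c (g : hom b c) (f : hom a b) (x : F a) :
  free_map g << free_pt f x >> = << free_pt (compc f g) x >>.
Proof. exact: fgextU. Qed.

Lemma free_map1 c x : free_map (idc c) x = x.
Proof.
pose h : {additive {freeg (free_gen c)} -> {freeg (free_gen c)}} := idfun.
rewrite -[RHS]/(h x); apply: (@freeg_morph_ext _ _ _ h) => -[a [f y]].
by rewrite free_mapE compcf1.
Qed.

Lemma free_mapM a b c (f : hom a b) (g : hom b c) x :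
  free_map (compc f g) x = free_map g (free_map f x).
Proof.
pose h : {additive {freeg (free_gen a)} -> {freeg (free_gen c)}} := free_map g \o free_map f.
rewrite -[RHS]/(h x); apply: (@freeg_morph_ext _ _ _ h) => -[d [k y]].
by rewrite -[RHS]/(free_map g (free_map f _)) !free_mapE compcA.
Qed.

Definition free_cover : functor C :=
  @Functor C (fun c => {freeg (free_gen c)}) free_map free_map1 free_mapM.

Definition counit_at c : {additive free_cover c -> F c} :=
  fgext (fun u : free_gen c => fmap F (tagged u).1 (tagged u).2).

Lemma counit_atE a c (f : hom a c) (x : F a) : counit_at c << free_pt f x >> = fmap F f x.
Proof. exact: fgextU. Qed.

Lemma counit_natural a b (f : hom a b) x :
  counit_at b (fmap free_cover f x) = fmap F f (counit_at a x).
Proof.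
pose h : {additive {freeg (free_gen a)} -> F b} := counit_at b \o free_map f.
pose k : {additive {freeg (free_gen a)} -> F b} := fmap F f \o counit_at a.
rewrite -[LHS]/(h x) -[RHS]/(k x); apply: (@freeg_morph_ext _ _ h k) => -[d [g y]].
rewrite -[LHS]/(counit_at b (free_map f _)) -[RHS]/(fmap F f (counit_at a _)).
by rewrite free_mapE !counit_atE fmapM.
Qed.

Definition free_counit : nattrans free_cover F :=
  @NatTrans C free_cover F counit_at counit_natural.

Lemma free_counit_surj a y : exists x, free_counit a x = y.
Proof.
exists << free_pt (idc a) y >>.
by rewrite counit_atE fmap1.
Qed.

Lemma free_cover_projective : projective free_cover.
Proof.
move=> G H p u psurj.
have [s sP] : {s : forall a, H a -> G a | forall a y, p a (s a y) = y}.
  exists (fun a y => sval (cid (psurj a y))) => a y.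
  exact: (svalP (cid (psurj a y))).
pose g a (x : F a) : G a := s a (u a << free_pt (idc a) x >>).
pose v c : {additive free_cover c -> G c} :=
  fgext (fun w : free_gen c => fmap G (tagged w).1 (g _ (tagged w).2)).
have vE a c (f : hom a c) (x : F a) : v c << free_pt f x >> = fmap G f (g a x).
  exact: fgextU.
have vn a b (f : hom a b) x : v b (fmap free_cover f x) = fmap G f (v a x).
  pose h : {additive {freeg (free_gen a)} -> G b} := v b \o free_map f.
  pose k : {additive {freeg (free_gen a)} -> G b} := fmap G f \o v a.
  rewrite -[LHS]/(h x) -[RHS]/(k x); apply: (@freeg_morph_ext _ _ h k) => -[d [e y]].
  rewrite -[LHS]/(v b (free_map f _)) -[RHS]/(fmap G f (v a _)).
  by rewrite free_mapE !vE fmapM.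
exists (NatTrans vn) => a x.
pose h : {additive {freeg (free_gen a)} -> H a} := p a \o v a.
rewrite -[LHS]/(h x); apply: (@freeg_morph_ext _ _ h) => -[d [e y]].
rewrite -[LHS]/(p a (v a _)) vE naturality /g sP -naturality.
by rewrite -[fmap free_cover _ _]/(free_map _ _) free_mapE compc1f.
Qed.

End FreeCover.

Section KernelFunctor.
Variables (C : category) (F G : functor C) (u : nattrans F G).

Definition in_ker c : {pred F c} := fun x => u c x == 0.

Lemma in_ker_zmod_closed c : zmod_closed (@in_ker c).
Proof.
split; first by rewrite unfold_in raddf0.
by move=> x y /eqP ux /eqP uy; rewrite unfold_in raddfB ux uy subrr.
Qed.

HB.instance Definition _ c :=
  GRing.isZmodClosed.Build (F c) (@in_ker c) (@in_ker_zmod_closed c).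

Record ker_at c := KerAt { ker_val : F c; _ : ker_val \in @in_ker c }.

HB.instance Definition _ c := [isSub for @ker_val c].
HB.instance Definition _ c := [Choice of ker_at c by <:].
HB.instance Definition _ c := [SubChoice_isSubZmodule of ker_at c by <:].

Lemma ker_map_subproof a b (f : hom a b) (x : ker_at a) :
  fmap F f (val x) \in @in_ker b.
Proof.
rewrite unfold_in naturality; have /eqP -> := valP x.
by rewrite raddf0.
Qed.

Let ker_map_fun a b (f : hom a b) (x : ker_at a) : ker_at b :=
  KerAt (ker_map_subproof f x).

Let ker_map_is_zmod_morphism a b (f : hom a b) : zmod_morphism (ker_map_fun f).
Proof. by move=> x y; apply: val_inj; rewrite /= !raddfB. Qed.

Let ker_map a b (f : hom a b) : {additive ker_at a -> ker_at b} :=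
  HB.pack (ker_map_fun f)
    (GRing.isZmodMorphism.Build _ _ (ker_map_fun f) (ker_map_is_zmod_morphism f)).

Lemma ker_map1 a x : ker_map (idc a) x = x.
Proof. by apply: val_inj; rewrite /= fmap1. Qed.

Lemma ker_mapM a b c (f : hom a b) (g : hom b c) x :
  ker_map (compc f g) x = ker_map g (ker_map f x).
Proof. by apply: val_inj; rewrite /= fmapM. Qed.

Definition kernel : functor C := @Functor C ker_at ker_map ker_map1 ker_mapM.

Definition kernel_in : nattrans kernel F :=
  @NatTrans C kernel F (fun c => val : {additive ker_at c -> F c})
    (fun _ _ _ _ => erefl).

End KernelFunctor.

Definition nattrans_comp (C : category) (F G H : functor C)
    (u : nattrans F G) (v : nattrans G H) : nattrans F H.
Proof.
exists (fun a => v a \o u a : {additive F a -> H a}) => a b f x.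
by rewrite /= !naturality.
Defined.

Section FreeResolution.
Variables (C : category) (F : functor C).

Fixpoint syzygy (n : nat) : functor C :=
  if n is m.+1 then kernel (free_counit (syzygy m)) else F.

Definition free_res (n : nat) : functor C := free_cover (syzygy n).

Definition free_res_bd n : nattrans (free_res n.+1) (free_res n) :=
  nattrans_comp (free_counit (syzygy n.+1)) (kernel_in (free_counit (syzygy n))).

Lemma free_res_exact0 a x :
  free_counit F a x = 0 <-> exists y, free_res_bd 0 a y = x.
Proof.
split=> [/eqP ux|[y <-]]; last exact/eqP/(valP (free_counit (syzygy 1) a y)).
have [y yx] := free_counit_surj (KerAt ux : syzygy 1 a).
by exists y; rewrite /= yx.
Qed.

Lemma free_res_exactS n a x :
  free_res_bd n a x = 0 <-> exists y, free_res_bd n.+1 a y = x.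
Proof.
split=> [ux|[y <-]].
  have kx : x \in @in_ker _ _ _ (free_counit (syzygy n.+1)) a.
    by rewrite unfold_in; apply/eqP/val_inj.
  have [y yx] := free_counit_surj (KerAt kx : syzygy n.+2 a).
  by exists y; rewrite /= yx.
have /eqP := valP (free_counit (syzygy n.+2) a y).
by rewrite /= => ->.
Qed.

Definition free_resolution : projective_resolution F :=
  @ProjectiveResolution C F free_res free_res_bd (free_counit F)
    (fun n => @free_cover_projective C (syzygy n)) (@free_counit_surj C F)
    free_res_exact0 free_res_exactS.

End FreeResolution.

(* [cat_homology C F n] is the value at [F] of the [n]-th left derived functor
   of [colim]; another projective resolution gives an isomorphic group. *)
Definition cat_homology (C : category) (F : functor C) (n : nat) : zmodType :=
  homology (colim_complex (free_resolution F)) n.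

Section Trace.
Variables (E : choiceType) (I : rel E).

(* The congruence on words generated by [ab = ba] for [(a, b)] in [I]. *)
Inductive trace_cong : seq E -> seq E -> Prop :=
| trace_refl u : trace_cong u u
| trace_sym u v : trace_cong u v -> trace_cong v u
| trace_trans v u w : trace_cong u v -> trace_cong v w -> trace_cong u w
| trace_swap a b u v : I a b ->
    trace_cong (u ++ [:: a; b] ++ v) (u ++ [:: b; a] ++ v).

Definition trace_congb : rel (seq E) := fun u v => `[< trace_cong u v >].

Lemma trace_congb_equiv : equiv_class_of trace_congb.
Proof.
split=> [u|u v|v u w].
- by apply/asboolP; exact: trace_refl.
- by apply/asboolP/asboolP; exact: trace_sym.
- by move=> /asboolP uv /asboolP vw; apply/asboolP; exact: trace_trans uv vw.
Qed.

Canonical trace_equiv := EquivRelPack trace_congb_equiv.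
Canonical trace_encModRel := defaultEncModRel trace_congb.

Definition trace := {eq_quot trace_congb}.

HB.instance Definition _ := EqQuotient.on trace.
HB.instance Definition _ := Choice.on trace.

Lemma trace_piP u v : \pi_trace u = \pi_trace v <-> trace_cong u v.
Proof.
split=> [/eqmodP/asboolP //|uv].
by apply/eqmodP/asboolP.
Qed.

Lemma trace_cong_cat u u' v v' :
  trace_cong u u' -> trace_cong v v' -> trace_cong (u ++ v) (u' ++ v').
Proof.
move=> uu' vv'; apply: (@trace_trans (u' ++ v)).
  elim: uu' => {u u'} [u|u u' _ H|u' u u'' _ H _ H'|a b x y ab].
  - exact: trace_refl.
  - exact: trace_sym.
  - exact: trace_trans H H'.
  - by rewrite -!catA; exact: (@trace_swap a b x (y ++ v)).
elim: vv' => {v v'} [v|v v' _ H|v' v v'' _ H _ H'|a b x y ab].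
- exact: trace_refl.
- exact: trace_sym.
- exact: trace_trans H H'.
- by rewrite !(catA u'); exact: trace_swap.
Qed.

Definition trace_one : trace := \pi_trace [::].
Definition trace_mul (mu nu : trace) : trace := \pi_trace (repr mu ++ repr nu).

Lemma trace_pi_cat u v :
  trace_mul (\pi_trace u) (\pi_trace v) = \pi_trace (u ++ v).
Proof.
by apply/trace_piP; apply: trace_cong_cat; apply/trace_piP; rewrite reprK.
Qed.

Lemma trace_mulA : associative trace_mul.
Proof.
move=> x y z; rewrite -[x]reprK -[y]reprK -[z]reprK.
rewrite (trace_pi_cat (repr y)) (trace_pi_cat (repr x) (repr y)).
by rewrite (trace_pi_cat _ (_ ++ _)) (trace_pi_cat (_ ++ _)) catA.
Qed.

Lemma trace_mul1l : left_id trace_one trace_mul.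
Proof. by move=> x; rewrite -[x]reprK trace_pi_cat. Qed.

Lemma trace_mul1r : right_id trace_one trace_mul.
Proof. by move=> x; rewrite -[x]reprK trace_pi_cat cats0. Qed.

HB.instance Definition _ :=
  isMonoid.Build trace trace_mulA trace_mul1l trace_mul1r.

Definition trace_gen (e : E) : trace := \pi_trace [:: e].

End Trace.

Record state_space (S E : choiceType) := StateSpace {
  indep : rel E;
  tran : S -> E -> S -> Prop;
  indep_irr : irreflexive indep;
  indep_sym : symmetric indep;
  tran_occurs : forall e, exists s s', tran s e s';
  tran_det : forall s e s' s'', tran s e s' -> tran s e s'' -> s' = s'';
  tran_swap : forall e1 e2 s s1 u, indep e1 e2 -> tran s e1 s1 -> tran s1 e2 u ->
    exists2 s2, tran s e2 s2 & tran s2 e1 u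
}.

Record async_system (S E : choiceType) := AsyncSystem {
  space :> state_space S E;
  init : S
}.

Section Action.
Variables (S E : choiceType) (T : state_space S E).

(* [None] is the added state [*]. *)
Definition step (s : option S) (e : E) : option S :=
  if s is Some x then xget None [set Some y | y in tran T x e] else None.

Lemma step_tran x e y : tran T x e y -> step (Some x) e = Some y.
Proof.
move=> t; apply: xget_unique; first by exists y.
by move=> _ [z tz <-]; rewrite (tran_det t tz).
Qed.

Lemma step_Some x e y : step (Some x) e = Some y -> tran T x e y.
Proof. by rewrite /=; case: xgetP => // z -> [w tw <-] [<-]. Qed.

Lemma step_indep a b s : indep T a b -> step (step s a) b = step (step s b) a.
Proof.
case: s => // s.
have half c d y : indep T c d -> step (step (Some s) c) d = Some y ->
    step (step (Some s) d) c = Some y.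
  move=> cd; case sc: (step (Some s) c) => [s1|] // s1d.
  have [s2 t2 t1] := tran_swap cd (step_Some sc) (step_Some s1d).
  by rewrite (step_tran t2) (step_tran t1).
move=> ab; have ba : indep T b a by rewrite indep_sym.
case xa: (step (step _ a) b) => [y|]; first by rewrite (half _ _ _ ab xa).
by case xb: (step (step _ b) a) => [y|//]; rewrite (half _ _ _ ba xb) in xa.
Qed.

Definition act (s : option S) (mu : trace (indep T)) : option S :=
  foldl step s (repr mu).

Lemma act_pi s w : act s (\pi_(trace (indep T)) w) = foldl step s w.
Proof.
have foldP u v : trace_cong (indep T) u v -> foldl step s u = foldl step s v.
  elim=> {u v} [u|u v _ ->|v u u' _ -> _ ->|a b u v ab] //.
  by rewrite !foldl_cat /= step_indep.
by apply: foldP; apply/trace_piP; rewrite reprK.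
Qed.

Lemma act1 s : act s 1%g = s.
Proof. by rewrite -[1%g]/(\pi_(trace (indep T)) [::]) act_pi. Qed.

Lemma actM s mu nu : act s (mu * nu)%g = act (act s mu) nu.
Proof.
rewrite -[mu]reprK -[nu]reprK -[(_ * _)%g]/(trace_mul _ _) trace_pi_cat.
by rewrite !act_pi foldl_cat.
Qed.

Lemma act_gen s e : act s (trace_gen _ e) = step s e.
Proof. exact: act_pi. Qed.

End Action.

Section Available.
Variables (S E : choiceType) (T : async_system S E).

Definition available : set (option S) :=
  [set s | exists mu, s = act (T := T) (Some (init T)) mu].

Lemma available_act (s : available) (mu : trace (indep T)) :
  act (val s) mu \in available.
Proof.
have := set_valP s; case=> nu sE.
by apply/mem_set; exists (nu * mu)%g; rewrite actM -sE.
Qed.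

Definition av_act (s : available) (mu : trace (indep T)) : available :=
  exist _ (act (val s) mu) (available_act s mu).

Definition av_hom (s1 s2 : available) : choiceType :=
  {mu : trace (indep T) | av_act s1 mu == s2}.

Lemma av_id_subproof (s : available) : av_act s 1%g == s.
Proof. by apply/eqP/val_inj; rewrite /= act1. Qed.

Lemma av_comp_subproof (s1 s2 s3 : available) (mu : av_hom s1 s2)
  (nu : av_hom s2 s3) : av_act s1 (val mu * val nu)%g == s3.
Proof.
apply/eqP/val_inj; rewrite /= actM.
have /eqP/(congr1 val) /= nuE := valP nu.
by have /eqP/(congr1 val) /= -> := valP mu.
Qed.

Definition av_id s : av_hom s s := exist _ 1%g (av_id_subproof s).

Definition av_comp s1 s2 s3 (mu : av_hom s1 s2) (nu : av_hom s2 s3) : av_hom s1 s3 :=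
  exist _ (val mu * val nu)%g (av_comp_subproof mu nu).

Lemma av_comp1f s1 s2 (mu : av_hom s1 s2) : av_comp (av_id s1) mu = mu.
Proof. by apply: val_inj; rewrite /= mul1g. Qed.

Lemma av_compf1 s1 s2 (mu : av_hom s1 s2) : av_comp mu (av_id s2) = mu.
Proof. by apply: val_inj; rewrite /= mulg1. Qed.

Lemma av_compA s1 s2 s3 s4 (f : av_hom s1 s2) (g : av_hom s2 s3) (h : av_hom s3 s4) :
  av_comp f (av_comp g h) = av_comp (av_comp f g) h.
Proof. by apply: val_inj; rewrite /= mulgA. Qed.

(* [K_*(T(s0))] *)
Definition av_category : category :=
  @Category (available : choiceType) av_hom av_id av_comp av_comp1f av_compf1 av_compA.

End Available.

Definition no_infinite_indep (S E : choiceType) (T : state_space S E) : Prop :=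
  forall A : set E,
    (forall a b, A a -> A b -> a <> b -> indep T a b) -> finite_set A.

Section CubicalComplex.
Variables (S : choiceType) (disp : Order.disp_t) (E : orderType disp).
Variable T : async_system S E.

Definition is_clique n : pred (n.-tuple E) :=
  fun t => sorted <%O t && pairwise (indep T) t.

Definition clique n : choiceType := {t : n.-tuple E | is_clique t}.

Lemma is_cliqueP n (t : n.-tuple E) :
  reflect (forall i j : 'I_n, (i < j)%N ->
             (tnth t i < tnth t j)%O && indep T (tnth t i) (tnth t j))
          (is_clique t).
Proof.
rewrite /is_clique sorted_pairwise; last exact: lt_trans.
case: n t => [|n] t; first by rewrite tuple0; apply: ReflectT => -[].
pose x0 := thead t.
apply: (iffP andP) => [[/(pairwiseP x0) tlt /(pairwiseP x0) tI] i j ij|H].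
  by rewrite !(tnth_nth x0) tlt ?tI ?inE ?size_tuple.
split; apply/(pairwiseP x0) => i j; rewrite !inE !size_tuple => ilt jlt ij;
by have /andP[] := H (Ordinal ilt) (Ordinal jlt) ij; rewrite !(tnth_nth x0).
Qed.

Definition del_tuple n (i : 'I_n.+1) (t : n.+1.-tuple E) : n.-tuple E :=
  [tuple tnth t (fintype.lift i j) | j < n].

Lemma del_subproof n (i : 'I_n.+1) (t : clique n.+1) : is_clique (del_tuple i (val t)).
Proof.
apply/is_cliqueP => j k jk; rewrite !tnth_mktuple.
apply: (is_cliqueP _ (valP t)).
by rewrite /= /bump; case: (leqP i j) => ij; case: (leqP i k) => ik; lia.
Qed.

Definition del n (i : 'I_n.+1) (t : clique n.+1) : clique n :=
  exist _ (del_tuple i (val t)) (del_subproof i t).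

Definition cube n : choiceType := (available T * clique n)%type.

Definition ev n (t : clique n) (i : 'I_n) : E := tnth (val t) i.

Definition av_step (s : available T) (e : E) : available T :=
  av_act s (trace_gen _ e).

(* Positions are numbered from [0], hence the exponent [i.+1]. *)
Definition cube_bd n (c : cube n.+1) : {freeg (cube n)} :=
  let: (s, t) := c in
  \sum_(i < n.+1) (-1) ^+ i.+1 *:
    (<< (av_step s (ev t i), del i t) : cube n >> - << (s, del i t) : cube n >>).

Definition cubical_d n : {additive {freeg (cube n.+1)} -> {freeg (cube n)}} :=
  fgext (@cube_bd n).

(* Deletes the original positions [i] and [j.+1], in both orders. *)
Lemma del_del n (i j : 'I_n.+1) (i' j' : 'I_n.+2) (t : clique n.+2) :
  (i <= j)%N -> i' = i :> nat -> j' = j.+1 :> nat ->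
  del j (del i' t) = del i (del j' t).
Proof.
move=> ij i'E j'E; apply/val_inj/eq_from_tnth => k; rewrite !tnth_mktuple.
congr tnth; apply: val_inj; rewrite /= /bump i'E j'E.
by case: (leqP j k); case: (leqP i k) => /=; lia.
Qed.

Lemma ev_del n (i : 'I_n.+1) (t : clique n.+1) j :
  ev (del i t) j = ev t (fintype.lift i j).
Proof. by rewrite /ev tnth_mktuple. Qed.

Lemma ev_indep n (t : clique n) (i j : 'I_n) :
  i != j -> indep T (ev t i) (ev t j).
Proof.
have H := is_cliqueP _ (valP t).
case: (ltngtP i j) => [ij|ji|/val_inj ->]; last by rewrite eqxx.
  by have /andP[] := H _ _ ij.
by have /andP[_] := H _ _ ji; rewrite indep_sym.
Qed.

Lemma av_step_indep s a b : indep T a b ->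
  av_step (av_step s a) b = av_step (av_step s b) a.
Proof. by move=> ab; apply: val_inj; rewrite /= !act_gen step_indep. Qed.

Lemma cubical_dd n x : cubical_d n (cubical_d n.+1 x) = 0.
Proof.
pose h : {additive {freeg (cube n.+2)} -> {freeg (cube n)}} :=
  cubical_d n \o cubical_d n.+1.
pose z : {additive {freeg (cube n.+2)} -> {freeg (cube n)}} := \0.
rewrite -[LHS]/(h x) -[RHS]/(z x); apply: (@freeg_morph_ext _ _ h z) => -[s t].
rewrite -[LHS]/(cubical_d n (cubical_d n.+1 _)) -[RHS]/(0 : {freeg (cube n)}).
have dU m c : cubical_d m << c >> = cube_bd c by exact: fgextU.
pose Q (i : 'I_n.+2) (j : 'I_n.+1) : {freeg (cube n)} :=
  let t' := del j (del i t) in let e := ev t i in let e' := ev (del i t) j in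
  (<< (av_step (av_step s e) e', t') >> - << (av_step s e, t') >>)
  - (<< (av_step s e', t') >> - << (s, t') >>).
have -> : cubical_d n (cubical_d n.+1 << (s, t) >>) =
    \sum_(i < n.+2) \sum_(j < n.+1) (-1) ^+ (i + j) *: Q i j.
  rewrite dU /cube_bd raddf_sum; apply: eq_bigr => i _.
  rewrite raddfZsign raddfB /= !dU /cube_bd -sumrB scaler_sumr.
  apply: eq_bigr => j _.
  by rewrite -scalerBr scalerA -exprD addSnnS !addnS !exprS !mulN1r opprK.
rewrite pair_big /= (bigID (fun p : 'I_n.+2 * 'I_n.+1 => (p.1 <= p.2)%N)) /=.
pose f (p : 'I_n.+2 * 'I_n.+1) : 'I_n.+2 * 'I_n.+1 :=
  (fintype.lift ord0 p.2, inord p.1).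
pose g (p : 'I_n.+2 * 'I_n.+1) : 'I_n.+2 * 'I_n.+1 :=
  (widen_ord (leqnSn _) p.2, inord p.1.-1).
apply/eqP; rewrite addr_eq0 -sumrN; apply/eqP.
rewrite [RHS](reindex_onto f g) /=; last first.
  case=> i j /=; rewrite -ltnNge => ji; congr pair; apply: val_inj => /=.
    by rewrite inordK /bump ?leq0n ?add1n; move: (ltn_ord i); lia.
  by rewrite inord_val.
rewrite [LHS]big_mkcond [RHS]big_mkcond; apply: eq_bigr => -[i j] _ /=.
have [ij|ji] := leqP i j; last first.
  case: ifP => // /andP[+ /eqP[/(congr1 val) /= ii _]].
  by rewrite ii /bump leq0n add1n ji.
have ii : @inord n i = i :> nat by rewrite inordK //; move: (ltn_ord j); lia.
have -> : g (f (i, j)) = (i, j).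
  by rewrite /f /g /= inord_val; congr pair; apply: val_inj.
rewrite ii /bump leq0n add1n -ltnNge ltnS ij eqxx /=.
rewrite addSn addnC exprS mulN1r scaleNr opprK; congr (_ *: _).
have dd := @del_del n (inord i) j i (fintype.lift ord0 j) t.
rewrite /Q !ev_del dd ?ii //.
have -> : fintype.lift i j = fintype.lift ord0 j.
  by apply: val_inj; rewrite /= /bump ij.
have -> : fintype.lift (fintype.lift ord0 j) (inord i) = i.
  by apply: val_inj; rewrite /= ii /bump leq0n add1n ltnNge ij.
rewrite (@av_step_indep s (ev t i)).
  by rewrite !opprD !opprK addrACA.
by apply: ev_indep; rewrite -val_eqE /= /bump leq0n add1n; lia.
Qed.

Definition cubical_complex : chain_complex := ChainComplex cubical_dd.

End CubicalComplex.

(* Main.v *)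
(* The functors C -> Ab free on the cubes (s, e_1 < ... < e_n), each placed at the
   object s.e_1...e_n, form a projective resolution of the constant functor Z: at an
   object a it has as basis the cells (s, e_1 < ... < e_n, mu) with s.e_1...e_n.mu = a,
   and the i-th faces of such a cell are (s.e_i, .., mu) and (s, .., e_i mu), e_i being
   deleted from the tuple. Its colimit is the cubical complex. For exactness, let e be
   the least letter dividing nu = e_1...e_n mu on the left; moving e from mu to the front
   of the tuple is a homotopy contracting the faces (s, .., e_i mu), which preserve nu,
   while the faces (s.e_i, .., mu) shorten nu. So the full differential is exact by
   induction on the length of nu. *)

From HB Require Import structures.
From mathcomp Require Import all_boot all_order all_algebra.
From mathcomp Require Import boolp classical_sets.
From mathcomp.multinomials Require Import freeg.
From mathcomp Require Import zify.
Require Import Defs.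

Set Implicit Arguments.
Unset Strict Implicit.
Unset Printing Implicit Defensive.

Import Order.TTheory GRing.Theory.
Local Open Scope ring_scope.
Local Open Scope quotient_scope.

Lemma isomorphic_trans (A B C : zmodType) :
  isomorphic A B -> isomorphic B C -> isomorphic A C.
Proof.
move=> [f fb] [g gb]; exists (g \o f : {additive A -> C}).
exact: bij_comp.
Qed.

(** * Chain maps and homology *)

Section HomologyMap.
Variables (X Y : chain_complex) (f : forall n, {additive X n -> Y n}).
Hypothesis f_bd : forall n x, f n (bd X n x) = bd Y n (f n.+1 x).
Variable n : nat.

Lemma chain_map_cycle (z : cycle X n) : f n (val z) \in @is_cycle Y n.
Proof.
case: n z => [|m] z //.
have /eqP dz : is_cycle (val z) := valP z.
by rewrite unfold_in -f_bd dz raddf0.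
Qed.

Let cycle_fun (z : cycle X n) : cycle Y n := Cycle (chain_map_cycle z).

Let cycle_fun_is_zmod_morphism : zmod_morphism cycle_fun.
Proof. by move=> z w; apply: val_inj; rewrite /= raddfB. Qed.

Definition cycle_map : {additive cycle X n -> cycle Y n} :=
  HB.pack cycle_fun
    (GRing.isZmodMorphism.Build _ _ cycle_fun cycle_fun_is_zmod_morphism).

Definition cycle_class : {additive cycle X n -> homology Y n} :=
  \pi_(homology Y n) \o cycle_map.

Lemma cycle_class_boundary z : z \in @is_boundary X n -> cycle_class z = 0.
Proof.
move=> /asboolP[x xz]; apply/eqP; rewrite quot_eq0; apply/asboolP.
by exists (f n.+1 x); rewrite -f_bd xz.
Qed.

Definition homology_map : {additive homology X n -> homology Y n} :=
  quot_lift cycle_class_boundary.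

Lemma homology_mapE z :
  homology_map (\pi_(homology X n) z) = \pi_(homology Y n) (cycle_map z).
Proof. exact: quot_liftE. Qed.

End HomologyMap.

Lemma homology_map_cancel (X Y : chain_complex)
    (f : forall n, {additive X n -> Y n}) (g : forall n, {additive Y n -> X n})
    (f_bd : forall n x, f n (bd X n x) = bd Y n (f n.+1 x))
    (g_bd : forall n x, g n (bd Y n x) = bd X n (g n.+1 x)) n :
  (forall z, z \in @is_cycle X n -> exists y, bd X n y = g n (f n z) - z) ->
  cancel (homology_map f_bd n) (homology_map g_bd n).
Proof.
move=> gf z; rewrite -[z]reprK; move: (repr z) => w.
rewrite (homology_mapE f_bd) (homology_mapE g_bd); apply/eqP.
rewrite -subr_eq0 -raddfB quot_eq0; apply/asboolP.
by have [y yE] := gf _ (valP w); exists y; rewrite yE raddfB.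
Qed.

(** The conditions concern cycles only: a homotopy formula loses its term [s d] there, and what
    remains says that [g f] and [f g] are the identity on homology classes. *)
Lemma homology_isomorphic (X Y : chain_complex)
    (f : forall n, {additive X n -> Y n}) (g : forall n, {additive Y n -> X n})
    (f_bd : forall n x, f n (bd X n x) = bd Y n (f n.+1 x))
    (g_bd : forall n x, g n (bd Y n x) = bd X n (g n.+1 x)) n :
  (forall z, z \in @is_cycle X n -> exists y, bd X n y = g n (f n z) - z) ->
  (forall z, z \in @is_cycle Y n -> exists y, bd Y n y = f n (g n z) - z) ->
  isomorphic (homology X n) (homology Y n).
Proof.
move=> gf fg; exists (homology_map f_bd n).
by exists (homology_map g_bd n); exact: homology_map_cancel.
Qed.

(** Builds chain maps and homotopies degree by degree. Any invariant needed for the next choice is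
    packed into the types [A n], so that [R] is total. *)
Lemma dependent_choice_nat (A : nat -> Type) (R : forall n, A n -> A n.+1 -> Prop)
    (a0 : A 0) :
  (forall n a, exists b, R n a b) ->
  exists2 a : forall n, A n, a 0 = a0 & forall n, R n (a n) (a n.+1).
Proof.
move=> total.
pose a := fix a n : A n :=
  if n is m.+1 then sval (cid (total m (a m))) else a0.
by exists a => // n; exact: (svalP (cid (total n (a n)))).
Qed.

(** * Lifting against projectives, and functoriality of the colimit *)

Section NaturalTransformations.
Variable C : category.

Definition nattrans_id (F : functor C) : nattrans F F :=
  @NatTrans C F F (fun=> idfun) (fun _ _ _ _ => erefl).

Definition nattrans_sub (F G : functor C) (u v : nattrans F G) : nattrans F G.
Proof.
exists (fun a => u a \- v a : {additive F a -> G a}) => a b f x.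
by rewrite /= !naturality raddfB.
Defined.

Section ToKernel.
Variables (F G H : functor C) (u : nattrans F G) (r : nattrans G H).
Hypothesis ru : forall a x, r a (u a x) = 0.

Lemma to_kernel_subproof a x : u a x \in in_ker r (c := a).
Proof. by rewrite unfold_in ru. Qed.

Let to_kernel_fun a (x : F a) : ker_at r a := KerAt (to_kernel_subproof x).

Let to_kernel_is_zmod_morphism a : zmod_morphism (@to_kernel_fun a).
Proof. by move=> x y; apply: val_inj; rewrite /= raddfB. Qed.

Let to_kernel_at a : {additive F a -> ker_at r a} :=
  HB.pack (@to_kernel_fun a)
    (GRing.isZmodMorphism.Build _ _ (@to_kernel_fun a) (@to_kernel_is_zmod_morphism a)).

Lemma to_kernel_natural a b (f : hom a b) x :
  to_kernel_at b (fmap F f x) = fmap (kernel r) f (to_kernel_at a x).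
Proof. by apply: val_inj; rewrite /= naturality. Qed.

Definition to_kernel : nattrans F (kernel r) :=
  @NatTrans C F (kernel r) to_kernel_at to_kernel_natural.

End ToKernel.

(** Exactness makes [q] a pointwise surjection onto the kernel of [r], and [u] factors through this
    kernel, so projectivity applies there. *)
Lemma projective_lift (P F G H : functor C) (q : nattrans F G) (r : nattrans G H)
    (u : nattrans P G) :
  projective P -> (forall a x, r a x = 0 <-> exists y, q a y = x) ->
  (forall a x, r a (u a x) = 0) ->
  exists v : nattrans P F, forall a x, q a (v a x) = u a x.
Proof.
move=> projP exq ru.
have rq a x : r a (q a x) = 0 by apply/exq; exists x.
have [|v vP] := projP _ _ (to_kernel rq) (to_kernel ru).
  move=> a y; have /exq[x xy] : r a (val y) = 0 by apply/eqP; exact: (valP y).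
  by exists x; apply: val_inj.
by exists v => a x; have /(congr1 val) := vP a x.
Qed.

Lemma colim_ext (F : functor C) (A : zmodType) (f g : {additive colim F -> A}) :
  (forall a (x : F a), f (colim_in x) = g (colim_in x)) -> f =1 g.
Proof.
move=> fg.
pose c a : {additive F a -> A} := f \o @colim_in C F a.
have cc a b (m : hom a b) x : c b (fmap F m x) = c a x.
  by rewrite /c /= colim_in_fmap.
move=> z; rewrite (colim_desc_uniq cc (g := f)) //.
by rewrite (colim_desc_uniq cc (g := g)) // => a x; rewrite -fg.
Qed.

Lemma eq_colim_map (F G : functor C) (u v : nattrans F G) :
  (forall a x, u a x = v a x) -> colim_map u =1 colim_map v.
Proof. by move=> uv; apply: colim_ext => a x; rewrite !colim_mapE uv. Qed.

Lemma colim_map_id (F : functor C) : colim_map (nattrans_id F) =1 id.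
Proof.
pose h : {additive colim F -> colim F} := idfun.
by move=> z; rewrite -[RHS]/(h z); apply: colim_ext => a x; rewrite colim_mapE.
Qed.

Lemma colim_map_comp (F G H : functor C) (u : nattrans F G) (v : nattrans G H) z :
  colim_map (nattrans_comp u v) z = colim_map v (colim_map u z).
Proof.
pose h : {additive colim F -> colim H} := colim_map v \o colim_map u.
rewrite -[RHS]/(h z); apply: colim_ext => a x.
by rewrite -[RHS]/(colim_map v (colim_map u _)) !colim_mapE.
Qed.

Lemma colim_map_sub (F G : functor C) (u v : nattrans F G) z :
  colim_map (nattrans_sub u v) z = colim_map u z - colim_map v z.
Proof.
pose h : {additive colim F -> colim G} := colim_map u \- colim_map v.
rewrite -[RHS]/(h z); apply: colim_ext => a x.
rewrite -[RHS]/(colim_map u (colim_in x) - colim_map v (colim_in x)).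
by rewrite !colim_mapE -raddfB.
Qed.

End NaturalTransformations.

(** * Comparison of projective resolutions *)

Section Comparison.
Variables (C : category) (F : functor C).

Lemma res_bd_bd (P : projective_resolution F) n a x :
  res_bd P n a (res_bd P n.+1 a x) = 0.
Proof. by apply/res_exactS; exists x. Qed.

Lemma res_aug_bd (P : projective_resolution F) a x :
  res_aug P a (res_bd P 0 a x) = 0.
Proof. by apply/res_exact0; exists x. Qed.

Lemma resolution_map (P Q : projective_resolution F) :
  exists2 f : forall n, nattrans (P n) (Q n),
    forall a x, res_aug Q a (f 0 a x) = res_aug P a x &
    forall n a x, res_bd Q n a (f n.+1 a x) = f n a (res_bd P n a x).
Proof.
(* The invariant for the next lift: [u] after the differential of [P] is killed by the differential
   of [Q], or by the augmentation in degree 0. *)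
pose good n : nattrans (P n) (Q n) -> Prop :=
  match n return nattrans (P n) (Q n) -> Prop with
  | 0 => fun u => forall a x, res_aug Q a (u a (res_bd P 0 a x)) = 0
  | m.+1 => fun u => forall a x, res_bd Q m a (u a (res_bd P m.+1 a x)) = 0
  end.
have [u0 u0E] := @res_projective C F P 0 _ _ (res_aug Q) (res_aug P)
  (@res_aug_surj C F Q).
have good0 : good 0 u0 by move=> a x; rewrite u0E res_aug_bd.
pose A n := {u : nattrans (P n) (Q n) | good n u}.
pose R n (u : A n) (v : A n.+1) :=
  forall a x, res_bd Q n a (sval v a x) = sval u a (res_bd P n a x).
have total n (u : A n) : exists v, R n u v.
  pose w := nattrans_comp (res_bd P n) (sval u).
  have [v vE] : exists v : nattrans (P n.+1) (Q n.+1),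
      forall a x, res_bd Q n a (v a x) = w a x.
    case: n u @w => [|n] [u gu] w.
      exact: (projective_lift (u := w) (@res_projective _ _ P 1) (@res_exact0 _ _ Q) gu).
    exact: (projective_lift (u := w) (@res_projective _ _ P _) (@res_exactS _ _ Q n) gu).
  have gv : good n.+1 v by move=> a x; rewrite vE /= res_bd_bd raddf0.
  by exists (exist _ v gv).
have [f f0 fR] := dependent_choice_nat (exist _ u0 good0 : A 0) total.
exists (fun n => sval (f n)) => [a x|n]; last exact: fR.
by rewrite f0 u0E.
Qed.

(** A chain map over the zero map of [F] is null-homotopic: in each degree [u - s d] lands in the
    cycles of [Q], which are boundaries, so it lifts. *)
Lemma resolution_homotopy (P Q : projective_resolution F)
    (u : forall n, nattrans (P n) (Q n)) :
  (forall a x, res_aug Q a (u 0 a x) = 0) ->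
  (forall n a x, res_bd Q n a (u n.+1 a x) = u n a (res_bd P n a x)) ->
  exists2 s : forall n, nattrans (P n) (Q n.+1),
    forall a x, res_bd Q 0 a (s 0 a x) = u 0 a x &
    forall n a x, res_bd Q n.+1 a (s n.+1 a x) + s n a (res_bd P n a x) = u n.+1 a x.
Proof.
move=> u_aug u_bd.
have [s0 s0E] := projective_lift (@res_projective _ _ P 0) (@res_exact0 _ _ Q) u_aug.
(* The invariant [d s d = u d] is what remains of the homotopy equation after composing with [d]. It
   makes [u n.+1 - s d] a family of cycles. *)
pose A n := {s : nattrans (P n) (Q n.+1) |
  forall a x, res_bd Q n a (s a (res_bd P n a x)) = u n a (res_bd P n a x)}.
pose R n (s : A n) (t : A n.+1) := forall a x,
  res_bd Q n.+1 a (sval t a x) + sval s a (res_bd P n a x) = u n.+1 a x.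
have total n (s : A n) : exists t, R n s t.
  pose w := nattrans_sub (u n.+1) (nattrans_comp (res_bd P n) (sval s)).
  have [|t tE] := projective_lift (u := w) (@res_projective _ _ P n.+1)
    (@res_exactS _ _ Q n).
    by move=> a x; rewrite /= raddfB u_bd (svalP s) subrr.
  have gt a x : res_bd Q n.+1 a (t a (res_bd P n.+1 a x)) =
      u n.+1 a (res_bd P n.+1 a x).
    by rewrite tE /= res_bd_bd raddf0 subr0.
  by exists (exist _ t gt) => a x; rewrite /= tE /= subrK.
have [s sE sR] := dependent_choice_nat (exist _ s0 (fun a x => s0E a _) : A 0) total.
by exists (fun n => sval (s n)) => [a x|n]; [rewrite sE /= s0E|exact: sR].
Qed.

Section ColimitInverse.
Variables (P Q : projective_resolution F).
Variables (f : forall n, nattrans (P n) (Q n)) (g : forall n, nattrans (Q n) (P n)).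
Hypothesis f_aug : forall a x, res_aug Q a (f 0 a x) = res_aug P a x.
Hypothesis g_aug : forall a x, res_aug P a (g 0 a x) = res_aug Q a x.
Hypothesis f_bd : forall n a x, res_bd Q n a (f n.+1 a x) = f n a (res_bd P n a x).
Hypothesis g_bd : forall n a x, res_bd P n a (g n.+1 a x) = g n a (res_bd Q n a x).

(** The homotopy from the identity to [g f] consists of natural transformations, so it passes to
    colimits; on a cycle only its term [d s] survives. *)
Lemma colim_resolution_map_inv n (z : colim (P n)) :
  z \in @is_cycle (colim_complex P) n ->
  exists y, bd (colim_complex P) n y = colim_map (g n) (colim_map (f n) z) - z.
Proof.
pose u m := nattrans_sub (nattrans_comp (f m) (g m)) (nattrans_id (P m)).
have [||s s0 sS] := @resolution_homotopy P P u.
- by move=> a x; rewrite /= raddfB g_aug f_aug subrr.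
- by move=> m a x; rewrite /= raddfB g_bd f_bd.
move=> cz; exists (colim_map (s n) z).
rewrite -colim_map_comp -[X in _ - X]colim_map_id -colim_map_sub.
rewrite -[LHS]/(colim_map (res_bd P n) _) -colim_map_comp.
(* Degree 0 has no term [s d]; in higher degrees this term is applied to the boundary of [z], which
   vanishes. *)
case: n z cz => [|n] z cz; first exact: eq_colim_map.
pose w := nattrans_sub (u n.+1) (nattrans_comp (res_bd P n) (s n)).
rewrite (@eq_colim_map _ _ _ _ w) => [|a x]; last first.
  exact: canRL (addrK _) (sS n a x).
rewrite (colim_map_sub (u n.+1)) (colim_map_comp (res_bd P n)).
by rewrite -[colim_map (res_bd P n) z]/(bd (colim_complex P) n z) (eqP cz) raddf0 subr0.
Qed.

Lemma colim_map_bd n x :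
  colim_map (f n) (bd (colim_complex P) n x) =
  bd (colim_complex Q) n (colim_map (f n.+1) x).
Proof.
rewrite -[LHS]/(colim_map (f n) (colim_map (res_bd P n) x)).
rewrite -[RHS]/(colim_map (res_bd Q n) (colim_map (f n.+1) x)).
by rewrite -!colim_map_comp; apply: eq_colim_map => a y; rewrite /= f_bd.
Qed.

End ColimitInverse.

Lemma colim_homology_isomorphic (P Q : projective_resolution F) n :
  isomorphic (homology (colim_complex P) n) (homology (colim_complex Q) n).
Proof.
have [f f_aug f_bd] := resolution_map P Q.
have [g g_aug g_bd] := resolution_map Q P.
apply: (@homology_isomorphic (colim_complex P) (colim_complex Q)
  (fun m => colim_map (f m)) (fun m => colim_map (g m))
  (colim_map_bd f_bd) (colim_map_bd g_bd)).
  exact: colim_resolution_map_inv.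
exact: colim_resolution_map_inv.
Qed.

End Comparison.

(** * Free functors *)

Section FamilyFree.
Variables (C : category) (G : choiceType) (tgt : G -> C).

Definition fam_gen (c : C) : choiceType := {g : G & hom (tgt g) c}.
Definition fam_pt c g (m : hom (tgt g) c) : fam_gen c :=
  Tagged (fun g => hom (tgt g) c : choiceType) m.

Definition fam_map b c (f : hom b c) : {additive {freeg (fam_gen b)} -> {freeg (fam_gen c)}} :=
  fgext (fun u : fam_gen b => << fam_pt (compc (tagged u) f) >>).

Lemma fam_mapE b c (f : hom b c) g (m : hom (tgt g) b) :
  fam_map f << fam_pt m >> = << fam_pt (compc m f) >>.
Proof. exact: fgextU. Qed.

Lemma fam_map1 c x : fam_map (idc c) x = x.
Proof.
pose h : {additive {freeg (fam_gen c)} -> {freeg (fam_gen c)}} := idfun.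
rewrite -[RHS]/(h x); apply: (@freeg_morph_ext _ _ _ h) => -[g m].
by rewrite fam_mapE compcf1.
Qed.

Lemma fam_mapM a b c (f : hom a b) (g : hom b c) x :
  fam_map (compc f g) x = fam_map g (fam_map f x).
Proof.
pose h : {additive {freeg (fam_gen a)} -> {freeg (fam_gen c)}} := fam_map g \o fam_map f.
rewrite -[RHS]/(h x); apply: (@freeg_morph_ext _ _ _ h) => -[k m].
by rewrite -[RHS]/(fam_map g (fam_map f _)) !fam_mapE compcA.
Qed.

(** The direct sum of the linearized representable functors at the objects [tgt g]. *)
Definition fam_free : functor C :=
  @Functor C (fun c => {freeg (fam_gen c)}) fam_map fam_map1 fam_mapM.

Section Extension.
Variables (F : functor C) (y : forall g, F (tgt g)).

Definition fam_ext_at c : {additive fam_free c -> F c} :=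
  fgext (fun u : fam_gen c => fmap F (tagged u) (y (tag u))).

Lemma fam_ext_atE c g (m : hom (tgt g) c) : fam_ext_at c << fam_pt m >> = fmap F m (y g).
Proof. exact: fgextU. Qed.

Lemma fam_ext_natural a b (f : hom a b) x :
  fam_ext_at b (fmap fam_free f x) = fmap F f (fam_ext_at a x).
Proof.
pose h : {additive {freeg (fam_gen a)} -> F b} := fam_ext_at b \o fam_map f.
pose k : {additive {freeg (fam_gen a)} -> F b} := fmap F f \o fam_ext_at a.
rewrite -[LHS]/(h x) -[RHS]/(k x); apply: (@freeg_morph_ext _ _ h k) => -[g m].
rewrite -[LHS]/(fam_ext_at b (fam_map f _)) -[RHS]/(fmap F f (fam_ext_at a _)).
by rewrite fam_mapE !fam_ext_atE fmapM.
Qed.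

Definition fam_ext : nattrans fam_free F :=
  @NatTrans C fam_free F fam_ext_at fam_ext_natural.

Lemma fam_extE c g (m : hom (tgt g) c) : fam_ext c << fam_pt m >> = fmap F m (y g).
Proof. exact: fam_ext_atE. Qed.

End Extension.

(** By Yoneda, a natural transformation out of [fam_free] amounts to one element at each [tgt g]; it
    suffices to lift the images of the identity generators. *)
Lemma fam_free_projective : projective fam_free.
Proof.
move=> F H p u psurj.
pose y g : F (tgt g) := sval (cid (psurj _ (u _ << fam_pt (idc (tgt g)) >>))).
have yP g : p _ (y g) = u _ << fam_pt (idc (tgt g)) >>.
  exact: (svalP (cid (psurj _ (u _ << fam_pt (idc (tgt g)) >>)))).
exists (fam_ext y) => c x.
pose h : {additive {freeg (fam_gen c)} -> H c} := p c \o fam_ext y c.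
rewrite -[LHS]/(h x); apply: (@freeg_morph_ext _ _ h (u c)) => -[g m].
rewrite -[LHS]/(p c (fam_ext y c _)) fam_extE naturality yP -naturality.
by rewrite -[fmap fam_free _ _]/(fam_map _ _) fam_mapE compc1f.
Qed.

Let fam_label c : {additive fam_free c -> {freeg G}} :=
  fgext (fun u : fam_gen c => << tag u >>).

Let fam_labelE c g (m : hom (tgt g) c) : fam_label c << fam_pt m >> = << g >>.
Proof. exact: fgextU. Qed.

Let fam_label_map a b (f : hom a b) x :
  fam_label b (fmap fam_free f x) = fam_label a x.
Proof.
pose h : {additive {freeg (fam_gen a)} -> {freeg G}} := fam_label b \o fam_map f.
rewrite -[LHS]/(h x); apply: (@freeg_morph_ext _ _ h) => -[g m].
by rewrite -[LHS]/(fam_label b (fam_map f _)) fam_mapE !fam_labelE.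
Qed.

(** In the colimit every generator [m] is identified with the identity generator of its [g], so each
    representable summand contributes one copy of the integers. *)
Definition fam_colim : {additive colim fam_free -> {freeg G}} :=
  colim_desc fam_label_map.

Lemma fam_colimE c g (m : hom (tgt g) c) :
  fam_colim (colim_in (<< fam_pt m >> : fam_free c)) = << g >>.
Proof. by rewrite /fam_colim colim_descE fam_labelE. Qed.

Definition fam_colim_inv : {additive {freeg G} -> colim fam_free} :=
  fgext (fun g => colim_in (<< fam_pt (idc (tgt g)) >> : fam_free (tgt g))).

Lemma fam_colim_invE c g (m : hom (tgt g) c) :
  fam_colim_inv << g >> = colim_in (<< fam_pt m >> : fam_free c).
Proof.
apply: etrans (fgextU _ _) _; rewrite -(colim_in_fmap m).
by rewrite -[fmap fam_free _ _]/(fam_map _ _) fam_mapE compc1f.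
Qed.

Lemma fam_colimK : cancel fam_colim fam_colim_inv.
Proof.
pose h : {additive colim fam_free -> colim fam_free} := fam_colim_inv \o fam_colim.
pose i : {additive colim fam_free -> colim fam_free} := idfun.
move=> z; rewrite -[LHS]/(h z) -[RHS]/(i z); apply: colim_ext => c x.
pose h' : {additive fam_free c -> colim fam_free} := h \o @colim_in _ fam_free c.
pose i' : {additive fam_free c -> colim fam_free} := @colim_in _ fam_free c.
rewrite -[LHS]/(h' x) -[RHS]/(i' x); apply: (@freeg_morph_ext _ _ h' i') => -[g m].
rewrite -[LHS]/(fam_colim_inv (fam_colim (colim_in _))).
by rewrite (fam_colimE m) (fam_colim_invE m).
Qed.

Lemma fam_colim_invK : cancel fam_colim_inv fam_colim.
Proof.
pose h : {additive {freeg G} -> {freeg G}} := fam_colim \o fam_colim_inv.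
pose i : {additive {freeg G} -> {freeg G}} := idfun.
move=> z; rewrite -[LHS]/(h z) -[RHS]/(i z); apply: (@freeg_morph_ext _ _ h i) => g.
rewrite -[LHS]/(fam_colim (fam_colim_inv _)) (fam_colim_invE (idc (tgt g))).
exact: fam_colimE.
Qed.

End FamilyFree.

(** * Division in trace monoids *)

Section LeftDivision.
Variables (E : choiceType) (I : rel E).
Hypotheses (I_irr : irreflexive I) (I_sym : symmetric I).

Local Notation trace := (trace I).
Local Notation tr := (\pi_trace).
Local Notation gen := (trace_gen I).

Lemma trace_catE u v : tr (u ++ v) = (tr u * tr v)%g.
Proof. by rewrite -trace_pi_cat. Qed.

Lemma trace_consE e w : tr (e :: w) = (gen e * tr w)%g.
Proof. exact: (trace_catE [:: e]). Qed.

Lemma trace_nilE : tr [::] = 1%g :> trace.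
Proof. by []. Qed.

Lemma trace_gen_comm a b : I a b -> (gen a * gen b = gen b * gen a)%g.
Proof.
move=> ab; rewrite -!trace_catE; apply/trace_piP.
exact: (@trace_swap _ _ a b [::] [::]).
Qed.

Lemma trace_gen_commw e w : all (I e) w -> (gen e * tr w = tr w * gen e)%g.
Proof.
elim: w => [|a w IHw] /=; first by rewrite trace_nilE mulg1 mul1g.
case/andP=> ea /IHw ew; rewrite trace_consE mulgA trace_gen_comm //.
by rewrite -mulgA ew mulgA.
Qed.

(** Cancels the first [e] of the word, provided that all letters before it are independent of [e]; a
    dependent letter met earlier blocks the division. *)
Fixpoint ldiv_word (e : E) (w : seq E) : option trace :=
  if w is a :: v then
    if a == e then Some (tr v)
    else if I e a then omap (fun mu => gen a * mu)%g (ldiv_word e v) else None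
  else None.

Lemma ldiv_word_cong e u v : trace_cong I u v -> ldiv_word e u = ldiv_word e v.
Proof.
elim=> {u v} [u|u v _ ->|v u w _ -> _ ->|a b u v ab] //.
elim: u => [|c u IHu] /=; last first.
  case: ifP => // _; last by rewrite IHu.
  by congr Some; apply/trace_piP; exact: trace_swap.
have ba : I b a by rewrite I_sym.
have [aE|ane] := eqVneq a e; have [bE|bne] := eqVneq b e.
- by rewrite aE bE I_irr in ab.
- by rewrite -aE ab /= trace_consE.
- by rewrite -bE ba /= trace_consE.
case: (I e a) (I e b) => -[] //=; case: (ldiv_word e v) => //= mu.
by rewrite !mulgA (trace_gen_comm ab).
Qed.

Definition ldiv (e : E) (nu : trace) : option trace := ldiv_word e (repr nu).

Lemma ldiv_pi e w : ldiv e (tr w) = ldiv_word e w.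
Proof. by apply: ldiv_word_cong; apply/trace_piP; rewrite reprK. Qed.

Lemma ldiv1 e : ldiv e 1%g = None.
Proof. by rewrite -trace_nilE ldiv_pi. Qed.

Lemma ldiv_gen e nu : ldiv e (gen e * nu)%g = Some nu.
Proof. by rewrite -[nu]reprK -trace_consE ldiv_pi /= eqxx. Qed.

Lemma ldiv_gen_neq e a nu : a != e ->
  ldiv e (gen a * nu)%g = if I e a then omap (fun mu => gen a * mu)%g (ldiv e nu) else None.
Proof.
by move=> /negPf ae; rewrite -[nu]reprK -trace_consE !ldiv_pi /= ae.
Qed.

Lemma ldivK e nu mu : ldiv e nu = Some mu -> (gen e * mu)%g = nu.
Proof.
rewrite -[nu]reprK ldiv_pi; elim: (repr nu) mu => //= a w IHw mu.
rewrite trace_consE; have [-> [<-] //|_] := eqVneq a e.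
case: ifP => // ea; case: (ldiv_word e w) IHw => // k /(_ _ erefl) <- [<-].
by rewrite !mulgA (trace_gen_comm ea).
Qed.

(** To reach the front, an [e] that does not occur in [w] must come from [nu] and cross every letter
    of [w]. *)
Lemma ldiv_word_mem e w nu : ldiv e (tr w * nu)%g -> e \notin w ->
  all (I e) w /\ ldiv e nu.
Proof.
elim: w => [|a w IHw]; first by rewrite trace_nilE mul1g.
rewrite trace_consE -mulgA inE negb_or => + /andP[ea ew].
rewrite ldiv_gen_neq 1?eq_sym //= ; case: ifP => //= _ h.
by apply: IHw => //; case: (ldiv _ _) h.
Qed.

Lemma ldiv_mem e nu : ldiv e nu -> e \in repr nu.
Proof.
rewrite -[nu in ldiv e nu]reprK -[tr _]mulg1 => h.
by apply: contraT => /(ldiv_word_mem h)[_]; rewrite ldiv1.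
Qed.

Definition tlen (nu : trace) : nat := size (repr nu).

Lemma tlen_pi w : tlen (tr w) = size w.
Proof.
have cong u v : trace_cong I u v -> size u = size v.
  by elim=> {u v} [u|u v _ ->|v u w' _ -> _ ->|a b u v _] //; rewrite !size_cat.
by apply: cong; apply/trace_piP; rewrite reprK.
Qed.

Lemma tlenM mu nu : tlen (mu * nu)%g = (tlen mu + tlen nu)%N.
Proof. by rewrite -[mu]reprK -[nu]reprK -trace_catE !tlen_pi size_cat. Qed.

Lemma tlen_gen e : tlen (gen e) = 1.
Proof. exact: tlen_pi. Qed.

End LeftDivision.

(** * The least letter dividing a trace on the left *)

Section LeadingLetter.
Variables (disp : Order.disp_t) (E : orderType disp) (I : rel E).
Hypotheses (I_irr : irreflexive I) (I_sym : symmetric I).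

(** A left divisor occurs in every word representing [nu], so searching the letters of [repr nu]
    misses none of them. *)
Definition lead (nu : trace I) : option E :=
  ohead (sort <=%O [seq e <- repr nu | ldiv e nu]).

Lemma lead_ldiv nu e : lead nu = Some e -> ldiv e nu.
Proof.
rewrite /lead => h.
suff : e \in sort <=%O [seq e <- repr nu | ldiv e nu].
  by rewrite mem_sort mem_filter => /andP[].
by case: sort h => //= a s [->]; rewrite mem_head.
Qed.

Lemma lead_le nu e f : lead nu = Some e -> ldiv f nu -> (e <= f)%O.
Proof.
move=> + fnu; have fm := ldiv_mem I_irr I_sym fnu.
have : f \in sort <=%O [seq e <- repr nu | ldiv e nu].
  by rewrite mem_sort mem_filter fnu.
rewrite /lead; have := sort_sorted (@le_total _ E) [seq e <- repr nu | ldiv e nu].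
case: sort => //= a s sa; rewrite inE => /predU1P[-> [->] //|fs [<-]].
by have /allP := order_path_min le_trans sa; apply.
Qed.

Lemma lead_gen e nu : lead (trace_gen I e * nu)%g.
Proof.
have d := ldiv_gen I_irr I_sym e nu.
have : e \in sort <=%O [seq f <- repr (trace_gen I e * nu)%g | ldiv f (trace_gen I e * nu)%g].
  by rewrite mem_sort mem_filter d ldiv_mem // d.
by rewrite /lead; case: sort.
Qed.

End LeadingLetter.

(** * The total complex of cells *)

(** The pairs [(i, j)] and [(j + 1, i)] with [i <= j] exhaust the index set; they carry opposite
    signs and, by hypothesis, equal values. *)
Lemma alternating_sum_eq0 (V : lmodType int) n (Q : 'I_n.+2 -> 'I_n.+1 -> V) :
  (forall i j : 'I_n.+1, (i <= j)%N ->
     Q (fintype.lift ord0 j) i = Q (widen_ord (leqnSn _) i) j) ->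
  \sum_(i < n.+2) \sum_(j < n.+1) (-1) ^+ (i + j) *: Q i j = 0.
Proof.
move=> Qsym; pose f (i : 'I_n.+2) (j : 'I_n.+1) : V := (-1) ^+ (i + j) *: Q i j.
rewrite (eq_bigr (fun i : 'I_n.+2 => (\sum_(j < n.+1) if (i <= j)%N then f i j else 0) +
  \sum_(j < n.+1) if (i <= j)%N then 0 else f i j)); last first.
  move=> i _; rewrite -big_split /=; apply: eq_bigr => j _.
  by case: ifP => _; rewrite ?addr0 ?add0r.
(* The last row has no pair with [i <= j] and the first row has only such pairs. Dropping the two
   empty rows gives both halves the same index range. *)
rewrite big_split /= big_ord_recr [X in _ + X + _]big1 ?addr0 => [|j _]; last first.
  by rewrite leqNgt ltn_ord.
rewrite [X in _ + X]big_ord_recl [X in _ + (X + _)]big1 ?add0r //.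
rewrite [X in _ + X]exchange_big -big_split /=; apply: big1 => i _.
rewrite -big_split /=; apply: big1 => j _; rewrite /bump add1n ltnNge.
have [ij|ji] := leqP i j; last by rewrite /= addr0.
by rewrite /f Qsym //= /bump add1n addSn addnC exprS mulN1r scaleNr subrr.
Qed.

(** Only generators in the support of [x] have to be checked, so a bound on the support is available
    for each of them. *)
Lemma freeg_morph_ind (K : choiceType) (V : zmodType) (f : {additive {freeg K} -> V})
    (P : V -> Prop) x :
  P 0 -> (forall u v, P u -> P v -> P (u - v)) ->
  (forall k, k \in dom x -> P (f << k >>)) -> P (f x).
Proof.
move=> P0 PB Pf.
have PN u : P u -> P (- u) by move=> Pu; rewrite -sub0r; exact: PB.
have PD u v : P u -> P v -> P (u + v).
  by move=> Pu Pv; rewrite -[v]opprK; apply: PB => //; exact: PN.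
have PMn u m : P u -> P (u *+ m).
  by move=> Pu; elim: m => [|m IHm]; rewrite ?mulr0n // mulrS; exact: PD.
rewrite -[x]freeg_sumE raddf_sum big_seq; apply: big_ind => // k kx.
have -> : << coeff k x *g k >> = << k >> *~ coeff k x.
  by rewrite freegU_mulz; congr << _ *g _ >>; rewrite -[LHS]intz.
rewrite raddfMz; case: (coeff k x) => m; first by rewrite -pmulrn; exact/PMn/Pf.
by rewrite NegzE mulrNz -pmulrn; exact/PN/PMn/Pf.
Qed.

Section KoszulCells.
Variables (S : choiceType) (disp : Order.disp_t) (E : orderType disp).
Variable T : async_system S E.

Local Notation I := (indep T).
Local Notation trace := (trace (indep T)).
Local Notation gen := (trace_gen (indep T)).
Local Notation tr := (\pi_(trace)).
Local Notation available := (available T).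
Local Notation clique := (clique T).
Local Notation cube := (cube T).

Lemma del_tuple_cons0 n e (t : n.-tuple E) : del_tuple ord0 (cons_tuple e t) = t.
Proof.
apply: eq_from_tnth => j; rewrite tnth_mktuple.
by rewrite (tnth_nth e) (tnth_nth e) /= .
Qed.

Lemma del_tuple_cons n e (t : n.+1.-tuple E) i :
  del_tuple (fintype.lift ord0 i) (cons_tuple e t) = cons_tuple e (del_tuple i t).
Proof.
apply: eq_from_tnth => j; rewrite tnth_mktuple.
case: (unliftP ord0 j) => [k|] ->.
  rewrite [RHS]tnthS tnth_mktuple !(tnth_nth e) /=.
  by rewrite /bump !add1n ltnS /= addnS.
by rewrite !(tnth_nth e).
Qed.

Definition clique_tr n (t : clique n) : trace := tr (val t : n.-tuple E).

(** The letter at position [i] commutes with all others, so it can be moved to the front. No order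
    is assumed, which lets the induction run on plain tuples. *)
Lemma tuple_tr_del n (t : n.+1.-tuple E) (i : 'I_n.+1) :
  (forall j, j != i -> I (tnth t i) (tnth t j)) ->
  (gen (tnth t i) * tr (del_tuple i t) = tr t)%g.
Proof.
elim: n t i => [|n IHn] t i; case/tupleP: t => a t; case: (unliftP ord0 i) => [j|] -> ti.
- by have := ltn_ord j.
- by rewrite del_tuple_cons0 -trace_consE.
- rewrite del_tuple_cons tnthS /= !trace_consE mulgA trace_gen_comm; last first.
    by have := ti ord0 isT; rewrite tnthS tnth0.
  rewrite -mulgA IHn // => k kj.
  by have := ti (fintype.lift ord0 k); rewrite (inj_eq lift_inj) !tnthS; apply.
- by rewrite del_tuple_cons0 -trace_consE.
Qed.

Lemma clique_tr_del n (t : clique n.+1) i :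
  (gen (ev t i) * clique_tr (del i t) = clique_tr t)%g.
Proof.
by apply: tuple_tr_del => j ji; apply: ev_indep; rewrite eq_sym.
Qed.

Lemma clique_tr_delr n (t : clique n.+1) i :
  (clique_tr (del i t) * gen (ev t i) = clique_tr t)%g.
Proof.
rewrite -(clique_tr_del t i); apply/esym/trace_gen_commw/all_tnthP => j.
by rewrite -[tnth _ _]/(ev _ _) ev_del ev_indep // neq_lift.
Qed.

(** The object over which a cell lies is computed by [cell_end] and is not part of the type, so
    faces and homotopies need no transport along equalities of states. *)
Definition cell n : choiceType := (cube n * trace)%type.
Definition mk_cell n (s : available) (t : clique n) (mu : trace) : cell n := ((s, t), mu).

Definition cube_end n (c : cube n) : available := av_act c.1 (clique_tr c.2).
Definition cell_end n (x : cell n) : available := av_act (cube_end x.1) x.2.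
Definition cell_tr n (x : cell n) : trace := (clique_tr x.1.2 * x.2)%g.

Lemma av_actM (s : available) mu nu : av_act s (mu * nu)%g = av_act (av_act s mu) nu.
Proof. by apply: val_inj; rewrite /= actM. Qed.

Lemma cell_endE n (x : cell n) : cell_end x = av_act x.1.1 (cell_tr x).
Proof. by rewrite av_actM. Qed.

Definition face b n (i : 'I_n.+1) (x : cell n.+1) : cell n :=
  let: ((s, t), mu) := x in
  if b then mk_cell (av_step s (ev t i)) (del i t) mu
  else mk_cell s (del i t) (gen (ev t i) * mu)%g.

(** The cubical identities. Two faces of the same kind commute because the two deleted events are
    independent; for faces of different kinds, one changes the state and the other the trace. *)
Lemma face_face b b' n (i j : 'I_n.+1) (x : cell n.+2) : (i <= j)%N ->
  face b i (face b' (fintype.lift ord0 j) x) =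
  face b' j (face b (widen_ord (leqnSn _) i) x).
Proof.
case: x => -[s t] mu ij.
have dd : del i (del (fintype.lift ord0 j) t) = del j (del (widen_ord (leqnSn _) i) t).
  by apply/esym/del_del.
have eu : ev (del (fintype.lift ord0 j) t) i = ev t (widen_ord (leqnSn _) i).
  by rewrite ev_del; congr ev; apply: val_inj; rewrite /= /bump; lia.
have ev' : ev (del (widen_ord (leqnSn _) i) t) j = ev t (fintype.lift ord0 j).
  by rewrite ev_del; congr ev; apply: val_inj; rewrite /= /bump ij.
have ind : I (ev t (fintype.lift ord0 j)) (ev t (widen_ord (leqnSn _) i)).
  by apply: ev_indep; rewrite -val_eqE /= /bump; lia.
rewrite /face /mk_cell; case: b b' => -[] /=; rewrite dd eu ev' //.
- by rewrite (av_step_indep _ ind).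
- by rewrite !mulgA (trace_gen_comm ind).
Qed.

Lemma cell_tr_face0 n (i : 'I_n.+1) x : cell_tr (face false i x) = cell_tr x.
Proof. by case: x => -[s t] mu; rewrite /cell_tr /= mulgA clique_tr_delr. Qed.

Lemma cell_tr_face1 n (i : 'I_n.+1) x :
  (gen (ev x.1.2 i) * cell_tr (face true i x))%g = cell_tr x.
Proof. by case: x => -[s t] mu; rewrite /cell_tr /= mulgA clique_tr_del. Qed.

Lemma cell_end_face b n (i : 'I_n.+1) x : cell_end (face b i x) = cell_end x.
Proof.
rewrite !cell_endE; case: b; last by rewrite cell_tr_face0; case: x => -[].
by rewrite -(cell_tr_face1 i x) av_actM; case: x => -[].
Qed.

Definition face_sum b n : {additive {freeg (cell n.+1)} -> {freeg (cell n)}} :=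
  fgext (fun x => \sum_(i < n.+1) (-1) ^+ i.+1 *: << face b i x >>).

Lemma face_sumU b n (x : cell n.+1) :
  face_sum b n << x >> = \sum_(i < n.+1) (-1) ^+ i.+1 *: << face b i x >>.
Proof. exact: fgextU. Qed.

Definition koszul_d n : {additive {freeg (cell n.+1)} -> {freeg (cell n)}} :=
  face_sum true n \- face_sum false n.

Lemma koszul_dE n x : koszul_d n x = face_sum true n x - face_sum false n x.
Proof. by []. Qed.

Lemma face_sum_face_sum b b' n x :
  face_sum b n (face_sum b' n.+1 << x >>) =
  \sum_(i < n.+2) \sum_(j < n.+1) (-1) ^+ (i + j) *: << face b j (face b' i x) >>.
Proof.
rewrite face_sumU raddf_sum; apply: eq_bigr => i _.
rewrite raddfZsign /= face_sumU scaler_sumr; apply: eq_bigr => j _.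
by rewrite scalerA -exprD addSnnS !addnS !exprS !mulN1r opprK.
Qed.

Lemma koszul_dd n x : koszul_d n (koszul_d n.+1 x) = 0.
Proof.
pose h : {additive {freeg (cell n.+2)} -> {freeg (cell n)}} := koszul_d n \o koszul_d n.+1.
pose z : {additive {freeg (cell n.+2)} -> {freeg (cell n)}} := \0.
rewrite -[LHS]/(h x) -[RHS]/(z x); apply: (@freeg_morph_ext _ _ h z) => y.
rewrite -[LHS]/(koszul_d n (koszul_d n.+1 _)) -[RHS]/(0 : {freeg (cell n)}).
rewrite !koszul_dE !(raddfB (face_sum _ n)) !face_sum_face_sum -!sumrB.
(* All four terms are kept together: exchanging the two deletions fixes the two unmixed terms and
   swaps the two mixed ones. *)
pose Q (i : 'I_n.+2) (j : 'I_n.+1) : {freeg (cell n)} :=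
  << face true j (face true i y) >> - << face true j (face false i y) >>
  - (<< face false j (face true i y) >> - << face false j (face false i y) >>).
rewrite -[RHS](@alternating_sum_eq0 _ n Q).
  by apply: eq_bigr => i _; rewrite -!sumrB; apply: eq_bigr => j _; rewrite !scalerBr.
move=> i j ij; rewrite /Q !face_face // !opprD !opprK.
by rewrite -!addrA; congr (_ + _); rewrite addrCA.
Qed.

End KoszulCells.

(** * Exactness *)

Section KoszulExactness.
Variables (S : choiceType) (disp : Order.disp_t) (E : orderType disp).
Variable T : async_system S E.

Local Notation I := (indep T).
Local Notation gen := (trace_gen (indep T)).
Local Notation tr := (\pi_(trace (indep T))).
Local Notation clique := (clique T).
Local Notation cell := (cell T).
Local Notation face_sum := (face_sum T).
Local Notation koszul_d := (koszul_d T).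
Let I_irr := indep_irr T.
Let I_sym := indep_sym T.

(** When the leading letter already heads the tuple, prepending it again breaks strict monotonicity,
    so [insub] fails and the value is 0. *)
Definition homotopy_cell n (x : cell n) : {freeg (cell n.+1)} :=
  if lead (cell_tr x) is Some e then
    if (ldiv e x.2, insub (cons_tuple e (val x.1.2)) : option (clique n.+1))
      is (Some mu, Some t) then << mk_cell x.1.1 t mu >> else 0
  else 0.

Definition homotopy n : {additive {freeg (cell n)} -> {freeg (cell n.+1)}} :=
  fgext (@homotopy_cell n).

Lemma homotopyU n (x : cell n) : homotopy n << x >> = homotopy_cell x.
Proof. exact: fgextU. Qed.

Lemma homotopy_cons n s (t : clique n) (t' : clique n.+1) mu e :
  lead (cell_tr (mk_cell s t (gen e * mu)%g)) = Some e ->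
  val t' = cons_tuple e (val t) ->
  homotopy n << mk_cell s t (gen e * mu)%g >> = << mk_cell s t' mu >>.
Proof.
move=> le te; rewrite homotopyU /homotopy_cell le /= ldiv_gen //.
by rewrite -te valK.
Qed.

Lemma homotopy_head n s (t : clique n.+1) mu e :
  lead (cell_tr (mk_cell s t mu)) = Some e -> thead (val t) = e ->
  homotopy n.+1 << mk_cell s t mu >> = 0.
Proof.
move=> le te; rewrite homotopyU /homotopy_cell le.
case: (ldiv _ _) => // k; rewrite insubF //.
have -> : e = tnth (val t) ord0 by rewrite -te.
apply/negbTE/is_cliqueP => /(_ ord0 (fintype.lift ord0 ord0) isT).
by rewrite tnthS ltxx.
Qed.

Lemma lead_cell_tr n (x : cell n.+1) : exists e, lead (cell_tr x) = Some e.
Proof.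
have := lead_gen I_irr I_sym (ev x.1.2 ord0) (cell_tr (face true ord0 x)).
by rewrite cell_tr_face1; case: lead => // e _; exists e.
Qed.

Lemma lead_le_ev n (x : cell n) e (i : 'I_n) :
  lead (cell_tr x) = Some e -> (e <= ev x.1.2 i)%O.
Proof.
case: n x i => [|n] x i le; first by case: i.
apply: (lead_le I_irr I_sym le); rewrite -(cell_tr_face1 i) ldiv_gen //.
Qed.

(** Each letter of the tuple divides [cell_tr x], so [e] is at most the head. If it is strictly
    smaller, it does not occur in the tuple, hence commutes with all of it and divides the remaining
    trace. *)
Lemma lead_cell_cases n (x : cell n.+1) e : lead (cell_tr x) = Some e ->
  thead (val x.1.2) = e \/
  exists (t : clique n.+2) mu, val t = cons_tuple e (val x.1.2) /\ x.2 = (gen e * mu)%g.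
Proof.
move=> le; have [eh|eh] := eqVneq (thead (val x.1.2)) e; [by left|right].
have emin i : (e <= ev x.1.2 i)%O by exact: lead_le_ev le.
have hlt : (e < thead (val x.1.2))%O.
  by rewrite lt_neqAle eq_sym eh; exact: (emin ord0).
have /andP[st pt] : is_clique T (val x.1.2) := valP x.1.2.
have pe : path <%O e (val x.1.2 : n.+1.-tuple E).
  by move: st hlt; case/tupleP: (val x.1.2) => a u /=; rewrite theadE => -> ->.
have et : e \notin (val x.1.2 : n.+1.-tuple E).
  have /allP lt_e := order_path_min lt_trans pe.
  by apply/negP => /lt_e; rewrite ltxx.
have := lead_ldiv le; rewrite /cell_tr => /(ldiv_word_mem I_irr I_sym)/(_ et)[al].
case mE: (ldiv e x.2) => [mu|] // _.
have ct : is_clique T (cons_tuple e (val x.1.2)) by apply/andP; rewrite /= pe al pt.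
exists (Sub (cons_tuple e (val x.1.2)) ct : clique n.+2), mu.
by split; rewrite // (ldivK _ _ mE).
Qed.

Lemma homotopy_cell_tr n (x : cell n) y : y \in dom (homotopy n << x >>) ->
  cell_tr y = cell_tr x.
Proof.
rewrite homotopyU /homotopy_cell; case: lead => [e|]; last by rewrite dom0.
case mE: (ldiv e x.2) => [mu|]; last by rewrite dom0.
case: insubP => [t ct tE|]; last by rewrite dom0.
rewrite domU1 inE => /eqP ->; rewrite /cell_tr /= /clique_tr tE.
have /andP[_ /= /andP[al _]] := ct.
by rewrite trace_consE trace_gen_commw // -mulgA (ldivK _ _ mE).
Qed.

(** The lower faces preserve [cell_tr], so the same leading letter governs every term. The sign is
    that of the face at position 0. *)
Lemma koszul_homotopy n (x : cell n.+1) :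
  face_sum false n.+1 (homotopy n.+1 << x >>) +
  homotopy n (face_sum false n << x >>) = - << x >>.
Proof.
have [e le] := lead_cell_tr x; case: x le => -[s t] mu le.
have del0 m (u : clique m.+1) : val u = cons_tuple (ev u ord0) (val (del ord0 u)).
  rewrite /ev /=; case: u => u /= _; case/tupleP: u => a u.
  by rewrite del_tuple_cons0.
have le0 i : lead (cell_tr (face false i (mk_cell s t mu))) = Some e.
  by rewrite cell_tr_face0.
have [te|[t' [nu [tE muE]]]] : thead (val t) = e \/ exists (t' : clique n.+2) nu,
    val t' = cons_tuple e (val t) /\ mu = (gen e * nu)%g := lead_cell_cases le.
  (* Case where [e] heads the tuple: the homotopy kills the cell and all its faces that still begin
     with [e]. Only the face deleting [e] contributes, and it gives the cell back. *)
  have te0 : ev t ord0 = e by [].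
  rewrite (homotopy_head le te) raddf0 add0r face_sumU raddf_sum /= big_ord_recl.
  rewrite big1 => [|i _]; rewrite raddfZsign.
    rewrite addr0 scaleN1r; congr (- _).
    by apply: homotopy_cons (del0 _ t); rewrite [in RHS]te0; exact: le0.
  rewrite [X in _ *: X](_ : _ = 0) ?scaler0 //.
  case: n t te te0 i {del0} le0 {le} => [|n] t te te0 i le0; first by case: i.
  apply: homotopy_head (le0 _) _.
  by rewrite /= /thead tnth_mktuple -te /thead; congr tnth; apply: val_inj.
(* Case where [e] comes from the trace: deleting the new head gives the cell back. The other faces
   cancel in pairs, as prepending [e] shifts positions by one. *)
have te0 : ev t' ord0 = e by rewrite /ev tE.
have teS i : ev t' (fintype.lift ord0 i) = ev t i by rewrite /ev tE tnthS.
rewrite muE in le le0 *; rewrite (homotopy_cons le tE) !face_sumU raddf_sum /=.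
rewrite big_ord_recl -addrA -big_split /= big1 ?addr0 => [|i _].
  rewrite scaleN1r te0; congr (- << mk_cell s _ _ >>).
  by apply: val_inj; rewrite /= tE del_tuple_cons0.
have ind : I e (ev t i) by rewrite -te0 -teS; apply: ev_indep.
rewrite raddfZsign teS; move: (le0 i).
rewrite /= !mulgA -(trace_gen_comm ind) -mulgA => lei.
rewrite (homotopy_cons (t' := del (fintype.lift ord0 i) t') lei); last first.
  by rewrite /= tE del_tuple_cons.
by rewrite /bump add1n exprS mulN1r scaleNr addNr.
Qed.

(** The filtration by trace length. The inequality is strict, so that level 0 contains only the zero
    chain. *)
Definition bounded n k (x : {freeg (cell n)}) : Prop :=
  forall c, c \in dom x -> (tlen (cell_tr c) < k)%N.

Lemma bounded0 n k : bounded k (0 : {freeg (cell n)}).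
Proof. by move=> c; rewrite dom0. Qed.

Lemma boundedB n k (x y : {freeg (cell n)}) :
  bounded k x -> bounded k y -> bounded k (x - y).
Proof. by move=> bx b_y c /domB; rewrite mem_cat => /orP[/bx|/b_y]. Qed.

Lemma boundedD n k (x y : {freeg (cell n)}) :
  bounded k x -> bounded k y -> bounded k (x + y).
Proof. by move=> bx b_y c /domD_subset; rewrite mem_cat => /orP[/bx|/b_y]. Qed.

Lemma bounded_face_sum n k (x : {freeg (cell n.+1)}) :
  bounded k.+1 x -> bounded k (face_sum true n x).
Proof.
move=> bx; apply: freeg_morph_ind; [exact: bounded0|exact: boundedB|].
move=> c /bx; rewrite face_sumU => ck.
apply: big_ind => [||i _]; [exact: bounded0|exact: boundedD|].
have bi : bounded k (<< face true i c >> : {freeg (cell n)}).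
  move=> d; rewrite domU1 inE => /eqP ->.
  by move: ck; rewrite -(cell_tr_face1 i) tlenM tlen_gen.
rewrite -signr_odd scaler_sign; case: odd => //.
by rewrite -sub0r; apply: boundedB bi; exact: bounded0.
Qed.

Lemma bounded_homotopy n k (x : {freeg (cell n)}) :
  bounded k x -> bounded k (homotopy n x).
Proof.
move=> bx; apply: freeg_morph_ind; [exact: bounded0|exact: boundedB|].
by move=> c /bx ck d /homotopy_cell_tr ->.
Qed.

(** The lower faces enter [koszul_d] with a minus sign, which turns the [- id] of [koszul_homotopy]
    into the identity; the upper faces remain as an error term. *)
Lemma koszul_homotopyE n x :
  koszul_d n.+1 (homotopy n.+1 x) + homotopy n (koszul_d n x) =
  x + (face_sum true n.+1 (homotopy n.+1 x) + homotopy n (face_sum true n x)).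
Proof.
pose f : {additive {freeg (cell n.+1)} -> {freeg (cell n.+1)}} :=
  (koszul_d n.+1 \o homotopy n.+1) \+ (homotopy n \o koszul_d n).
pose g : {additive {freeg (cell n.+1)} -> {freeg (cell n.+1)}} :=
  idfun \+ ((face_sum true n.+1 \o homotopy n.+1) \+ (homotopy n \o face_sum true n)).
rewrite -[LHS]/(f x) -[RHS]/(g x); apply: (@freeg_morph_ext _ _ f g) => c.
rewrite -[LHS]/(koszul_d n.+1 (homotopy n.+1 << c >>) + homotopy n (koszul_d n << c >>)).
rewrite -[RHS]/(<< c >> + (face_sum true n.+1 (homotopy n.+1 << c >>) +
  homotopy n (face_sum true n << c >>))).
rewrite !koszul_dE (raddfB (homotopy n)) addrACA -opprD koszul_homotopy opprK.
by rewrite addrC.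
Qed.

Lemma koszul_exact n x : koszul_d n x = 0 -> exists y, koszul_d n.+1 y = x.
Proof.
have [k bx] : exists k, bounded k x.
  exists (\max_(c <- dom x) tlen (cell_tr c)).+1 => c cx.
  exact: (@leq_bigmax_seq _ (dom x) xpredT (fun c : cell n.+1 => tlen (cell_tr c)) c cx isT).
elim: k x bx => [|k IHk] x bx dx.
  exists 0; rewrite raddf0; apply/esym/eqP; rewrite -dom_eq0.
  by move: bx; rewrite /bounded; case: (dom x) => // c s /(_ c (mem_head _ _)).
(* The error term is again a cycle, since [x + z] is a boundary, and it lies one step lower in the
   filtration. *)
pose z := face_sum true n.+1 (homotopy n.+1 x) + homotopy n (face_sum true n x).
have xE : koszul_d n.+1 (homotopy n.+1 x) = x + z.
  by rewrite -koszul_homotopyE dx raddf0 addr0.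
have bz : bounded k z.
  apply: boundedD; first exact/bounded_face_sum/bounded_homotopy.
  exact/bounded_homotopy/bounded_face_sum.
have [|y yE] := IHk z bz.
  have := koszul_dd (homotopy n.+1 x).
  by rewrite xE raddfD dx add0r.
by exists (homotopy n.+1 x - y); rewrite raddfB xE yE addrK.
Qed.

Definition clique0 : clique 0 := Sub [tuple] isT.

Lemma clique0E (t : clique 0) : t = clique0.
Proof. by apply: val_inj; rewrite [LHS]tuple0 [RHS]tuple0. Qed.

(* [cell_end c] with the empty trace is the terminal object of the slice over [cell_end c]. *)
Definition to_end : {additive {freeg (cell 0)} -> {freeg (cell 0)}} :=
  fgext (fun c => << mk_cell (cell_end c) clique0 1%g >>).

Lemma to_endU c : to_end << c >> = << mk_cell (cell_end c) clique0 1%g >>.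
Proof. exact: fgextU. Qed.

(** Reading the trace letter by letter, the 1-cell with event [e] joins the vertex with trace [e w]
    at [s] to the vertex with trace [w] at [s.e]. Their sum telescopes to the vertex with empty
    trace. *)
Lemma koszul_exact0 x : exists y, koszul_d 0 y = x - to_end x.
Proof.
pose f : {additive {freeg (cell 0)} -> {freeg (cell 0)}} := idfun \- to_end.
rewrite -[_ - _]/(f x).
apply: (@freeg_morph_ind _ _ f (fun u => exists y, koszul_d 0 y = u))
    => [|u v [y <-] [z <-]|]; first by exists 0; rewrite raddf0.
  by exists (y - z); rewrite raddfB.
move=> -[[s t] mu] _; rewrite (clique0E t) -[f _]/(_ - to_end _) -[mu]reprK.
rewrite -/(mk_cell s clique0 (tr (repr mu))).
elim: (repr mu) s => [|e w IHw] s.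
  exists 0; rewrite raddf0 to_endU cell_endE trace_nilE.
  have -> : cell_tr (mk_cell s clique0 1%g) = 1%g by rewrite /cell_tr mulg1.
  have -> : av_act s 1%g = s by apply: val_inj; rewrite /= act1.
  by rewrite subrr.
have ce : is_clique T [tuple of [:: e]] by [].
pose t' : clique 1 := Sub [tuple of [:: e]] ce.
pose c := mk_cell s t' (tr w).
have [y yE] := IHw (av_step s e).
have endE : cell_end (mk_cell (av_step s e) clique0 (tr w)) =
    cell_end (mk_cell s clique0 (tr (e :: w))).
  by rewrite !cell_endE /cell_tr /= /clique_tr /= trace_nilE !mul1g trace_consE av_actM.
exists (y + << c >>).
rewrite raddfD yE koszul_dE !face_sumU !big_ord1 !scaleN1r opprK.
rewrite /face /= !(clique0E (del _ _)) !to_endU endE trace_consE.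
by rewrite addrC addrA; congr (_ - _); rewrite addrAC addNr add0r.
Qed.

End KoszulExactness.

(** * The resolution and its colimit *)

Section KoszulResolution.
Variables (S : choiceType) (disp : Order.disp_t) (E : orderType disp).
Variable T : async_system S E.

Local Notation trace := (trace (indep T)).
Local Notation cube := (cube T).
Local Notation cell := (cell T).
Local Notation koszul_d := (koszul_d T).
Local Notation C := (av_category T).

Definition koszul n : functor C := @fam_free C (cube n) (@cube_end _ _ _ T n).

Definition koszul_pt n (a : C) (c : cube n) (m : hom (cube_end c : C) a) : koszul n a :=
  << @fam_pt C (cube n) (@cube_end _ _ _ T n) a c m >>.

Lemma koszul_fmap n (a b : C) (f : hom a b) (c : cube n) (m : hom (cube_end c : C) a) :
  fmap (koszul n) f (koszul_pt m) = koszul_pt (compc m f).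
Proof. exact: fam_mapE. Qed.

Lemma koszul_ext n (a : C) (V : zmodType) (f g : {additive koszul n a -> V}) :
  (forall (c : cube n) (m : hom (cube_end c : C) a), f (koszul_pt m) = g (koszul_pt m)) ->
  f =1 g.
Proof. by move=> fg; apply: freeg_morph_ext => -[c m]; apply: fg. Qed.

(* [total] embeds [koszul n a] in the sum of the [koszul n b] over all [b], whose
   basis is [cell n], and [over] is the projection onto the summand of [a]. *)
Definition total n (a : C) : {additive koszul n a -> {freeg (cell n)}} :=
  fgext (fun u : @fam_gen C (cube n) (@cube_end _ _ _ T n) a =>
    << (tag u, val (tagged u)) : cell n >>).

Lemma totalU n a (c : cube n) (m : hom (cube_end c : C) a) :
  total n a (koszul_pt m) = << (c, val m) : cell n >>.
Proof. exact: fgextU. Qed.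

Definition over n (a : C) : {additive {freeg (cell n)} -> koszul n a} :=
  fgext (fun x : cell n =>
    if insub x.2 : option (av_hom (cube_end x.1) a) is Some m
    then koszul_pt (m : hom (cube_end x.1 : C) a) else 0).

Lemma over_in n a (c : cube n) (m : hom (cube_end c : C) a) :
  over n a << (c, val m) >> = koszul_pt m.
Proof. by rewrite [LHS]fgextU /= valK. Qed.

Lemma over_out n (a : C) (x : cell n) : cell_end x != a -> over n a << x >> = 0.
Proof. by move=> xa; rewrite [LHS]fgextU insubN. Qed.

Lemma totalK n a : cancel (total n a) (over n a).
Proof.
pose f : {additive koszul n a -> koszul n a} := over n a \o total n a.
pose g : {additive koszul n a -> koszul n a} := idfun.
move=> x; rewrite -[LHS]/(f x) -[RHS]/(g x); apply: koszul_ext => c m.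
by rewrite -[LHS]/(over n a (total n a _)) totalU over_in.
Qed.

Lemma cell_overP n (a : C) (x : cell n) : cell_end x = a ->
  exists m : hom (cube_end x.1 : C) a, x.2 = val m.
Proof.
by move=> /eqP xa; exists (exist _ x.2 xa).
Qed.

Lemma overK n (a : C) (x : cell n) : cell_end x = a -> total n a (over n a << x >>) = << x >>.
Proof.
case: x => c mu /cell_overP[m /= ->].
by rewrite over_in totalU.
Qed.

Lemma over_dK n (a : C) (x : cell n.+1) : cell_end x = a ->
  total n a (over n a (koszul_d n << x >>)) = koszul_d n << x >>.
Proof.
move=> xa; rewrite koszul_dE !face_sumU -sumrB !raddf_sum.
apply: eq_bigr => i _; rewrite -scalerBr !raddfZsign !raddfB /=.
by rewrite !overK // cell_end_face.
Qed.

Definition cell_mulr n (mu : trace) : {additive {freeg (cell n)} -> {freeg (cell n)}} :=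
  fgext (fun x : cell n => << (x.1, x.2 * mu)%g : cell n >>).

Lemma cell_mulrU n mu (x : cell n) :
  cell_mulr n mu << x >> = << (x.1, x.2 * mu)%g : cell n >>.
Proof. exact: fgextU. Qed.

Lemma total_fmap n (a b : C) (m : hom a b) x :
  total n b (fmap (koszul n) m x) = cell_mulr n (val m) (total n a x).
Proof.
pose f : {additive koszul n a -> {freeg (cell n)}} := total n b \o fmap (koszul n) m.
pose g : {additive koszul n a -> {freeg (cell n)}} := cell_mulr n (val m) \o total n a.
rewrite -[LHS]/(f x) -[RHS]/(g x); apply: koszul_ext => c k.
rewrite -[LHS]/(total n b (fmap (koszul n) m (koszul_pt k))) koszul_fmap totalU.
by rewrite -[RHS]/(cell_mulr n (val m) (total n a (koszul_pt k))) totalU cell_mulrU.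
Qed.

Lemma koszul_d_mulr n mu x :
  koszul_d n (cell_mulr n.+1 mu x) = cell_mulr n mu (koszul_d n x).
Proof.
pose f : {additive {freeg (cell n.+1)} -> {freeg (cell n)}} := koszul_d n \o cell_mulr n.+1 mu.
pose g : {additive {freeg (cell n.+1)} -> {freeg (cell n)}} := cell_mulr n mu \o koszul_d n.
rewrite -[LHS]/(f x) -[RHS]/(g x); apply: (@freeg_morph_ext _ _ f g) => -[[s t] nu].
rewrite -[LHS]/(koszul_d n (cell_mulr n.+1 mu _)).
rewrite -[RHS]/(cell_mulr n mu (koszul_d n _)) cell_mulrU !koszul_dE !face_sumU -!sumrB.
rewrite raddf_sum; apply: eq_bigr => i _.
by rewrite -!scalerBr raddfZsign (raddfB (cell_mulr n mu)) !cell_mulrU /= mulgA.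
Qed.

(** Given by Yoneda on the generators with empty trace. Every face of such a cell lies over
    [cube_end c], so [over] loses nothing. *)
Definition koszul_bd n : nattrans (koszul n.+1) (koszul n) :=
  fam_ext (fun c => over n (cube_end c) (koszul_d n << (c, 1%g) : cell n.+1 >>)).

Lemma koszul_bd_pt n (a : C) (c : cube n.+1) (m : hom (cube_end c : C) a) :
  koszul_bd n a (koszul_pt m) =
  fmap (koszul n) m (over n (cube_end c) (koszul_d n << (c, 1%g) : cell n.+1 >>)).
Proof. exact: fam_extE. Qed.

Lemma total_bd n a x : total n a (koszul_bd n a x) = koszul_d n (total n.+1 a x).
Proof.
pose f : {additive koszul n.+1 a -> {freeg (cell n)}} := total n a \o koszul_bd n a.
pose g : {additive koszul n.+1 a -> {freeg (cell n)}} := koszul_d n \o total n.+1 a.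
rewrite -[LHS]/(f x) -[RHS]/(g x); apply: koszul_ext => c m.
rewrite -[LHS]/(total n a (koszul_bd n a (koszul_pt m))) koszul_bd_pt total_fmap.
rewrite over_dK; last by apply: val_inj; rewrite /= act1.
rewrite -[RHS]/(koszul_d n (total n.+1 a (koszul_pt m))) totalU -koszul_d_mulr.
by rewrite cell_mulrU mul1g.
Qed.

(** With [total_bd] and [totalK], this makes each complex [koszul n a] a direct summand of the
    complex of cells, from which it inherits exactness. *)
Lemma over_d n a x : over n a (koszul_d n x) = koszul_bd n a (over n.+1 a x).
Proof.
pose f : {additive {freeg (cell n.+1)} -> koszul n a} := over n a \o koszul_d n.
pose g : {additive {freeg (cell n.+1)} -> koszul n a} := koszul_bd n a \o over n.+1 a.
rewrite -[LHS]/(f x) -[RHS]/(g x); apply: (@freeg_morph_ext _ _ f g) => y.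
rewrite -[LHS]/(over n a (koszul_d n << y >>)).
rewrite -[RHS]/(koszul_bd n a (over n.+1 a << y >>)).
(* A cell over another object has all its faces over that object, so both sides vanish. *)
have [ya|ya] := eqVneq (cell_end y : C) a.
  by rewrite -{1}(overK ya) -total_bd totalK.
rewrite (over_out ya) raddf0 koszul_dE !face_sumU -sumrB raddf_sum big1 // => i _.
rewrite -scalerBr raddfZsign raddfB /= !over_out ?subrr ?scaler0 //.
all: by rewrite cell_end_face.
Qed.

Definition koszul_aug : nattrans (koszul 0) (constZ C) :=
  fam_ext (F := constZ C) (fun=> 1 : int).

Lemma koszul_augU a (c : cube 0) (m : hom (cube_end c : C) a) :
  koszul_aug a (koszul_pt m) = 1.
Proof. exact: fam_extE. Qed.

(** Over a fixed object [to_end] is the augmentation times one fixed generator, so [koszul_exact0]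
    yields exactness at the augmentation. *)
Lemma to_end_total a x :
  to_end T (total 0 a x) = << mk_cell a (clique0 T) 1%g >> *~ (koszul_aug a x).
Proof.
pose g : {additive koszul 0 a -> {freeg (cell 0)}} :=
  (fun z : int => << mk_cell a (clique0 T) 1%g >> *~ z) \o koszul_aug a.
pose f : {additive koszul 0 a -> {freeg (cell 0)}} := to_end T \o total 0 a.
rewrite -[LHS]/(f x) -[RHS]/(g x); apply: koszul_ext => c m.
rewrite -[LHS]/(to_end T (total 0 a (koszul_pt m))) totalU to_endU.
rewrite -[RHS]/(_ *~ koszul_aug a (koszul_pt m)) koszul_augU.
by congr << mk_cell _ _ _ >>; apply/eqP; exact: (valP m).
Qed.

Lemma to_end_d x : to_end T (koszul_d 0 x) = 0.
Proof.
pose f : {additive {freeg (cell 1)} -> {freeg (cell 0)}} := to_end T \o koszul_d 0.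
pose g : {additive {freeg (cell 1)} -> {freeg (cell 0)}} := \0.
rewrite -[LHS]/(f x) -[RHS]/(g x); apply: (@freeg_morph_ext _ _ f g) => c.
rewrite -[LHS]/(to_end T (koszul_d 0 << c >>)) koszul_dE !face_sumU !big_ord1.
by rewrite -scalerBr raddfZsign raddfB /= !to_endU !cell_end_face subrr scaler0.
Qed.

Lemma koszul_aug_surj a y : exists x, koszul_aug a x = y.
Proof.
have [m _] : exists m : hom (cube_end (a, clique0 T) : C) a, 1%g = val m.
  apply: (@cell_overP 0 a (mk_cell a (clique0 T) 1%g)).
  by rewrite cell_endE /cell_tr mulg1; apply: val_inj; rewrite /= act1.
exists (koszul_pt m *~ y); rewrite raddfMz koszul_augU.
exact: intz.
Qed.

Lemma koszul_bd_exact0 a x :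
  koszul_aug a x = 0 <-> exists y, koszul_bd 0 a y = x.
Proof.
split=> [x0|[y <-]].
  have [y yE] := koszul_exact0 (total 0 a x).
  exists (over 1 a y); rewrite -over_d yE to_end_total x0 mulr0z subr0.
  exact: totalK.
have := to_end_total (koszul_bd 0 a y); rewrite total_bd to_end_d freegU_mulz.
by move/esym/eqP; rewrite freegU_eq0 => /eqP; rewrite -[RHS]/(0 : int) intz.
Qed.

Lemma koszul_bd_exactS n a x :
  koszul_bd n a x = 0 <-> exists y, koszul_bd n.+1 a y = x.
Proof.
split=> [x0|[y <-]].
  have [|y yE] := koszul_exact (n := n) (x := total n.+1 a x).
    by rewrite -total_bd x0 raddf0.
  by exists (over n.+2 a y); rewrite -over_d yE totalK.
by apply: (can_inj (totalK (n := n) (a := a))); rewrite !total_bd koszul_dd raddf0.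
Qed.

Definition koszul_resolution : projective_resolution (constZ C) :=
  @ProjectiveResolution C (constZ C) koszul koszul_bd koszul_aug
    (fun n => @fam_free_projective C (cube n) (@cube_end _ _ _ T n))
    koszul_aug_surj koszul_bd_exact0 koszul_bd_exactS.

End KoszulResolution.

(** * The colimit of the resolution is the cubical complex *)

Section KoszulColimit.
Variables (S : choiceType) (disp : Order.disp_t) (E : orderType disp).
Variable T : async_system S E.

Local Notation cube := (cube T).
Local Notation cell := (cell T).
Local Notation koszul_d := (koszul_d T).
Local Notation koszul_bd := (koszul_bd T).
Local Notation koszul := (koszul T).
Local Notation C := (av_category T).

Definition cell_label n : {additive {freeg (cell n)} -> {freeg (cube n)}} :=
  fgext (fun x : cell n => << x.1 >>).

Lemma cell_labelU n (x : cell n) : cell_label n << x >> = << x.1 >>.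
Proof. exact: fgextU. Qed.

(** Once the trace is forgotten, the lower face with trace [e_i mu] becomes the cube at [s] with
    [e_i] deleted, which is the second term of [cube_bd]. *)
Lemma cell_label_d n x : cell_label n (koszul_d n x) = cubical_d T n (cell_label n.+1 x).
Proof.
pose f : {additive {freeg (cell n.+1)} -> {freeg (cube n)}} := cell_label n \o koszul_d n.
pose g : {additive {freeg (cell n.+1)} -> {freeg (cube n)}} :=
  cubical_d T n \o cell_label n.+1.
rewrite -[LHS]/(f x) -[RHS]/(g x); apply: (@freeg_morph_ext _ _ f g) => -[[s t] mu].
rewrite -[LHS]/(cell_label n (koszul_d n _)) -[RHS]/(cubical_d T n (cell_label n.+1 _)).
rewrite koszul_dE !face_sumU -sumrB raddf_sum cell_labelU.
rewrite [RHS](fgextU (@cube_bd S disp E T n)).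
apply: eq_bigr => i _.
by rewrite -scalerBr raddfZsign (raddfB (cell_label n)) !cell_labelU.
Qed.

Definition colim_koszul n : {additive colim (koszul n) -> {freeg (cube n)}} :=
  @fam_colim C (cube n) (@cube_end _ _ _ T n).

Definition colim_koszul_inv n : {additive {freeg (cube n)} -> colim (koszul n)} :=
  @fam_colim_inv C (cube n) (@cube_end _ _ _ T n).

Lemma colim_koszulE n (a : C) (x : koszul n a) :
  colim_koszul n (colim_in x) = cell_label n (total n a x).
Proof.
pose f : {additive koszul n a -> {freeg (cube n)}} :=
  colim_koszul n \o @colim_in C (koszul n) a.
pose g : {additive koszul n a -> {freeg (cube n)}} := cell_label n \o total n a.
rewrite -[LHS]/(f x) -[RHS]/(g x); apply: koszul_ext => c m.
rewrite -[RHS]/(cell_label n (total n a (koszul_pt m))) totalU cell_labelU.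
exact: fam_colimE.
Qed.

Lemma colim_koszul_bd n x :
  colim_koszul n (colim_map (koszul_bd n) x) = cubical_d T n (colim_koszul n.+1 x).
Proof.
pose f : {additive colim (koszul n.+1) -> {freeg (cube n)}} :=
  colim_koszul n \o colim_map (koszul_bd n).
pose g : {additive colim (koszul n.+1) -> {freeg (cube n)}} :=
  cubical_d T n \o colim_koszul n.+1.
rewrite -[LHS]/(f x) -[RHS]/(g x); apply: colim_ext => a y.
rewrite -[LHS]/(colim_koszul n (colim_map (koszul_bd n) (colim_in y))) colim_mapE.
rewrite -[RHS]/(cubical_d T n (colim_koszul n.+1 (colim_in y))) !colim_koszulE.
by rewrite total_bd cell_label_d.
Qed.

Lemma colim_koszul_inv_bd n x :
  colim_koszul_inv n (cubical_d T n x) = colim_map (koszul_bd n) (colim_koszul_inv n.+1 x).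
Proof.
apply: (can_inj (fam_colimK (C := C) (tgt := @cube_end _ _ _ T n))).
rewrite [LHS]fam_colim_invK -[RHS]/(colim_koszul n _) colim_koszul_bd.
by rewrite [colim_koszul n.+1 _]fam_colim_invK.
Qed.

Lemma koszul_homology_isomorphic n :
  isomorphic (homology (colim_complex (koszul_resolution T)) n)
             (homology (cubical_complex T) n).
Proof.
(* The two chain maps are mutually inverse, so the zero chain bounds the differences. *)
apply: (@homology_isomorphic (colim_complex (koszul_resolution T)) (cubical_complex T)
  colim_koszul colim_koszul_inv colim_koszul_bd colim_koszul_inv_bd) => z _; exists 0.
  by rewrite raddf0 [colim_koszul_inv n _]fam_colimK subrr.
by rewrite raddf0 [colim_koszul n _]fam_colim_invK subrr.
Qed.

End KoszulColimit.

Theorem corollary3p9 (S : choiceType) (disp : Order.disp_t) (E : orderType disp)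
    (T : async_system S E) (fin_indep : no_infinite_indep T) (n : nat) :
  isomorphic (cat_homology (constZ (av_category T)) n)
             (homology (cubical_complex T) n).
Proof.
apply: isomorphic_trans (koszul_homology_isomorphic T n).
exact: colim_homology_isomorphic.
Qed.
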